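(* Let $G$ be the group of polynomial automorphisms of $\mathbb{C}^2$ with Jacobian determinant equal to $1$. Then every non-trivial group endomorphism $\phi: G\to G$ is injective. In particular, $G$ is hopfian, i.e. every surjective group homomorphism $G\to G$ is an automorphism.
   Context: A polynomial automorphism of $\mathbb{C}^2$ is a bijection $(x,y)\mapsto (F_1(x,y),F_2(x,y))$ with $F_1,F_2\in\mathbb{C}[x,y]$ whose inverse is also polynomial. The group law is composition. $G$ is considered as an abstract group. An endomorphism is non-trivial if it does not send every element to the identity. *)

(* Defs.v *)
(* The complex numbers are R[i] for an arbitrary complete archimedean ordered
   field R : realType, i.e. for the real numbers up to unique isomorphism. *)
From HB Require Import structures.
From mathcomp Require Import all_boot all_order all_algebra.
From mathcomp Require Import boolp reals complex mpoly.

Set Implicit Arguments.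
Unset Strict Implicit.
Unset Printing Implicit Defensive.

Import Order.TTheory GRing.Theory Num.Theory.
Local Open Scope ring_scope.

Section PolynomialMaps.
Variable K : comNzRingType.
Variable n : nat.
Implicit Types F G : 'rV[{mpoly K[n]}]_n.

(* The map K^n -> K^n whose i-th component is the polynomial F 0 i. *)
Definition polymap F (p : 'rV[K]_n) : 'rV[K]_n := \row_i (F 0 i).@[p 0].

Definition jacobian F : 'M[{mpoly K[n]}]_n := \matrix_(i, j) (F 0 i)^`M(j).

Definition poly_id : 'rV[{mpoly K[n]}]_n := \row_i 'X_i.

Definition poly_comp G F : 'rV[{mpoly K[n]}]_n :=
  \row_i (G 0 i \mPo [tuple F 0 j | j < n]).

Lemma polymap_id : polymap poly_id = id.
Proof.
by apply/funext => p; apply/rowP => i; rewrite !mxE mevalXU.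
Qed.

Lemma polymap_comp G F : polymap (poly_comp G F) = polymap G \o polymap F.
Proof.
apply/funext => p; apply/rowP => i; rewrite !mxE comp_mpoly_meval.
by apply: meval_eq => j; rewrite tnth_mktuple mxE.
Qed.

Lemma jacobian_id : jacobian poly_id = 1%:M.
Proof.
apply/matrixP => i j; rewrite !mxE mderivX mnmE.
case: eqP => [->|_]; last by rewrite scale0r.
by rewrite scale1r -[X in (X - _)%MM]add0m addmK mpolyX0.
Qed.

Lemma mderiv_comp (p : {mpoly K[n]}) (t : n.-tuple {mpoly K[n]}) j :
  (p \mPo t)^`M(j) = \sum_i (p^`M(i) \mPo t) * (tnth t i)^`M(j).
Proof.
pose P (q : {mpoly K[n]}) :=
  (q \mPo t)^`M(j) = \sum_i (q^`M(i) \mPo t) * (tnth t i)^`M(j).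
have PC c : P c%:MP.
  by rewrite /P comp_mpolyC mderivC big1 // => i _;
     rewrite mderivC comp_mpoly0 mul0r.
have PD q r : P q -> P r -> P (q + r).
  rewrite /P => Pq Pr; rewrite comp_mpolyD mderivD Pq Pr -big_split.
  by apply: eq_bigr => i _; rewrite mderivD comp_mpolyD mulrDl.
have PM q r : P q -> P r -> P (q * r).
  rewrite /P => Pq Pr; rewrite rmorphM mderivM Pq Pr mulr_suml mulr_sumr.
  rewrite -big_split; apply: eq_bigr => i _ /=.
  rewrite mderivM comp_mpolyD !rmorphM /= mulrDl; congr (_ + _).
    by rewrite mulrAC.
  by rewrite mulrA.
have PX i : P 'X_i.
  rewrite /P comp_mpolyXU -tnth_nth (bigD1 i) //= big1 => [|k neq_ki].
    rewrite addr0 mderivX mnm1E eqxx scale1r.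
    by rewrite -[X in (X - _)%MM]add0m addmK mpolyX0 comp_mpoly1 mul1r.
  by rewrite mderivX mnm1E eq_sym (negPf neq_ki) scale0r comp_mpoly0 mul0r.
rewrite -/(P p); elim/mpolyind: p => [|c m p _ _ Pp].
  by rewrite -mpolyC0; apply: (PC).
apply: PD => //; rewrite -mul_mpolyC; apply: (PM); first exact: PC.
rewrite mpolyXE_id; apply: (big_ind P) => [|q r|i _]; [by rewrite -mpolyC1; apply: (PC)|exact: PM|].
elim: (m i) => [|k IHk]; first by rewrite expr0 -mpolyC1; apply: (PC).
by rewrite exprS; apply: PM.
Qed.

Lemma jacobian_comp G F :
  jacobian (poly_comp G F) =
  map_mx (comp_mpoly [tuple F 0 j | j < n]) (jacobian G) *m jacobian F.
Proof.
apply/matrixP => i j; rewrite !mxE mderiv_comp.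
by apply: eq_bigr => k _; rewrite !mxE tnth_mktuple.
Qed.

Lemma det_jacobian_comp G F :
  \det (jacobian (poly_comp G F)) =
  (\det (jacobian G) \mPo [tuple F 0 j | j < n]) * \det (jacobian F).
Proof. by rewrite jacobian_comp det_mulmx det_map_mx. Qed.

End PolynomialMaps.

Lemma poly_eval0 (K : numFieldType) (p : {poly K}) :
  (forall x, p.[x] = 0) -> p = 0.
Proof.
move=> p0; apply: contraTeq isT => /max_poly_roots.
move=> /(_ [seq i%:R | i <- iota 0 (size p)]).
rewrite size_map size_iota ltnn => abs; suff: false by [].
apply: abs; first by apply/allP => x _; rewrite rootE p0.
by rewrite map_inj_uniq ?iota_uniq // => i j /eqP; rewrite eqr_nat => /eqP.
Qed.

Lemma mpoly2_eval0 (K : numFieldType) (p : {mpoly K[2]}) :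
  (forall v : 'rV[K]_2, p.@[v 0] = 0) -> p = 0.
Proof.
move=> p0; have lift01 : lift ord0 ord0 = 1 :> 'I_2 by apply/val_inj.
pose h (i : 'I_2) : {poly {poly K}} := if i == 0 then 'X%:P else 'X.
pose q := mmap (polyC \o polyC) h p.
have qE : q = \sum_(m <- msupp p) p@_m *: 'X^(m 0) *: 'X^(m 1).
  apply: eq_bigr => m _; rewrite /mmap1 big_ord_recl big_ord1 /h /=.
  by rewrite lift01 -!mul_polyC polyCM polyC_exp mulrA.
have q_eval x y : q.[y%:P].[x] = 0.
  pose v : 'rV[K]_2 := \row_i (if i == 0 then x else y).
  rewrite -(p0 v) qE mevalE !horner_sum; apply: eq_bigr => m _.
  rewrite big_ord_recl big_ord1 !mxE /= lift01.
  by rewrite hornerZ hornerXn -polyC_exp hornerM hornerC hornerZ hornerXn mulrA.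
have q0 : q = 0.
  apply/polyP => j; apply/polyP => i; rewrite !coef0.
  pose r (x : K) : {poly K} := \poly_(k < size q) (q`_k : {poly K}).[x].
  have r0 x : r x = 0.
    apply: poly_eval0 => y; rewrite -(q_eval x y) horner_poly.
    rewrite (horner_coef q) horner_sum; apply: eq_bigr => k _.
    by rewrite -polyC_exp hornerM hornerC.
  have qj0 k : q`_k = 0.
    apply: poly_eval0 => x; have /polyP/(_ k) := r0 x.
    rewrite coef_poly coef0; case: ltnP => // le_qk _.
    by rewrite nth_default // horner0.
  by rewrite qj0 coef0.
apply/mpolyP => m; rewrite mcoeff0.
have <- : q`_(m 1%R)`_(m 0%R) = 0 by rewrite q0 !coef0.
rewrite qE !coef_sum [in LHS](mpolyE p) raddf_sum /=; apply: eq_bigr => m' _.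
rewrite mcoeffZ mcoeffX coefZ coefXn mulr_natr coefMn coefZ coefXn -mulrnAr.
rewrite -mulrnA mulnb; congr (_ * (nat_of_bool _)%:R).
apply/eqP/andP => [->|[/eqP e0 /eqP e1]]; first by rewrite !eqxx.
by apply/mnmP => i; case: (unliftP 0 i) => [k|] ->; rewrite ?ord1 ?lift01.
Qed.

Section SpecialAutomorphisms.
Variable R : realType.
Local Notation C := R[i].
Implicit Types f g : 'rV[C]_2 -> 'rV[C]_2.

(* The polynomials F are determined by the map f, see polymap_inj below. *)
Definition special_polyaut f : Prop :=
  exists F : 'rV[{mpoly C[2]}]_2,
    [/\ f = polymap F,
        exists G : 'rV[{mpoly C[2]}]_2,
          cancel f (polymap G) /\ cancel (polymap G) f
      & \det (jacobian F) = 1].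

Lemma polymap_inj : injective (@polymap C 2).
Proof.
move=> F G eqFG; apply/rowP => i; apply/eqP; rewrite -subr_eq0; apply/eqP.
apply: mpoly2_eval0 => v; rewrite mevalB.
have /(congr1 (fun f => f v 0 i)) := eqFG.
by rewrite !mxE => ->; rewrite subrr.
Qed.

Lemma special_polyaut1 : special_polyaut id.
Proof.
exists (poly_id C 2); rewrite polymap_id jacobian_id det1; split=> //.
by exists (poly_id C 2); rewrite polymap_id.
Qed.

Lemma special_polyautM f g :
  special_polyaut f -> special_polyaut g -> special_polyaut (f \o g).
Proof.
move=> [F [-> [F' [FK F'K]] detF]] [G [-> [G' [GK G'K]] detG]].
exists (poly_comp F G); rewrite polymap_comp det_jacobian_comp detF detG.
rewrite comp_mpoly1 mul1r; split=> //.
exists (poly_comp G' F'); rewrite polymap_comp.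
by split; apply: can_comp.
Qed.

Lemma special_polyautV f : special_polyaut f ->
  exists2 g, special_polyaut g & cancel f g /\ cancel g f.
Proof.
move=> [F [-> [G [FK GK]] detF]]; exists (polymap G); last by split.
exists G; split; [exact: erefl|by exists F|].
have GF : poly_comp F G = poly_id C 2.
  apply: polymap_inj; rewrite polymap_comp polymap_id.
  by apply/funext => v /=; rewrite GK.
have := det_jacobian_comp F G.
rewrite GF jacobian_id det1 detF comp_mpoly1 mul1r => detG.
exact: (esym detG).
Qed.

Record SAutC2 := MkSAutC2 {
  saut_fun :> 'rV[C]_2 -> 'rV[C]_2;
  _ : `[< special_polyaut saut_fun >] }.

HB.instance Definition _ := [isSub for saut_fun].
HB.instance Definition _ := [Choice of SAutC2 by <:].

Lemma saut_funP (f : SAutC2) : special_polyaut f.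
Proof. by apply/asboolP; case: f. Qed.

Definition saut_one : SAutC2 := MkSAutC2 (asboolT special_polyaut1).

Definition saut_mul (f g : SAutC2) : SAutC2 :=
  MkSAutC2 (asboolT (special_polyautM (saut_funP f) (saut_funP g))).

Definition saut_inv (f : SAutC2) : SAutC2 :=
  let g := cid2 (special_polyautV (saut_funP f)) in
  MkSAutC2 (asboolT (s2valP g)).

Lemma saut_mulA : associative saut_mul.
Proof. by move=> f g h; apply/val_inj. Qed.

Lemma saut_mul1 : left_id saut_one saut_mul.
Proof. by move=> f; apply/val_inj. Qed.

Lemma saut_1mul : right_id saut_one saut_mul.
Proof. by move=> f; apply/val_inj. Qed.

Lemma saut_mulV : left_inverse saut_one saut_inv saut_mul.
Proof.
move=> f; apply/val_inj/funext => p /=.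
by case: cid2 => g gP [fK gK] /=; rewrite fK.
Qed.

Lemma saut_Vmul : right_inverse saut_one saut_inv saut_mul.
Proof.
move=> f; apply/val_inj/funext => p /=.
by case: cid2 => g gP [fK gK] /=; rewrite gK.
Qed.

(* The product f * g is the composition f \o g. *)
HB.instance Definition _ := isGroup.Build SAutC2
  saut_mulA saut_mul1 saut_1mul saut_mulV saut_Vmul.

End SpecialAutomorphisms.

(* Main.v *)
From HB Require Import structures.
Require Import Defs.
From mathcomp Require Import all_boot all_order all_algebra.
From mathcomp Require Import boolp reals complex mpoly.
From mathcomp Require Import ring zify.

Set Implicit Arguments.
Unset Strict Implicit.
Unset Printing Implicit Defensive.

Import Order.TTheory GRing.Theory Num.Theory.
Local Open Scope ring_scope.

(** Why a nontrivial endomorphism phi of the group G is injective.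

    The idea is to show that phi is, up to conjugation, compatible with an
    injective map of the plane to itself. A point is the same thing as a
    translation applied to the origin, so it suffices to know that phi sends
    translations to translations, injectively, and that elements fixing the
    origin go to elements fixing one common point v0. Then the map that sends
    the translate of the origin by t to the translate of v0 by phi t
    intertwines f with phi f for every f, and phi f determines f
    (phi_injective).

    Generators. By Jung's theorem (jung_generation) G is generated by the
    shears (x + p(y), y) and the quarter turn (- y, x). The proof lowers the
    degrees of the components (f, g) of an automorphism (degree_reduction).
    Write a coordinate as P(f, g). The derivation h |-> Jac(f, h) acts on
    polynomials in f and g as the partial derivative in g and raises degrees by
    at most deg f - 2. Applied k times, where k is the multiplicity with which
    the leading weighted form of P vanishes at the leading forms of f and g, it
    yields an element whose degree is known exactly. The resulting inequality
    (wform_estimate) forces deg f to divide deg g, if deg f <= deg g, and the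
    leading form of g to be a multiple of a power of that of f.

    Kernel. A normal subgroup that contains a nontrivial shear is G
    (shear_kernel). So phi is injective on shears as soon as it is nontrivial.
    This does not settle the question, because G has nontrivial proper normal
    subgroups; they contain no nontrivial shear.

    The image of a translation. The translation t = (x + 1, y) is conjugate to
    its square and its cube, by diagonal maps. Words in affine and triangular
    maps that are cyclically reduced, if not a single letter, multiply degrees
    of curves by a factor d > 1, so they are not conjugate to their squares
    (trichotomy, deg_mult_not_conj_square). Hence phi t is conjugate to a
    triangular map (a x + p(y), y / a + b). If a is not 1, this map has a unique
    fixed point, and comparing traces of derivatives there with those of the
    square and the cube gives a contradiction (tri_power_conj). If a = 1 and b
    is not 0, it is conjugate to a translation. If a = 1 and b = 0 it is a
    shear, and a nonconstant shear has a centralizer that is abelian up to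
    finite index, whereas the centralizer of t is generated by divisible
    subgroups and is not abelian (phi_shear1_const).

    Normalization. Once phi t is a translation, centralizers and commutators
    determine the images of all shears (phi_shear), of the vertical
    translations (phi_normal_form) and of all translations (phi_transl). The
    point v0 is the unique fixed point of phi(- id), and roots of unity show
    that the images of shears fixing the origin fix v0 (common_fixed_point).

    A surjective endomorphism of G is nontrivial, hence bijective. *)

(** * Plane polynomials along curves *)

(** The coordinates of a point, or the components of a map, as a family
    indexed by 'I_2. *)
Definition xy T (a b : T) (i : 'I_2) : T := if i == 0 then a else b.

Lemma ord2P (i : 'I_2) : i = 0 \/ i = 1.
Proof. by case: i => [[|[|]]] // ?; [left|right]; apply/val_inj. Qed.

Lemma prod_ord2 (S : pzSemiRingType) (F : 'I_2 -> S) : \prod_i F i = F 0 * F 1.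
Proof. by rewrite big_ord_recl big_ord1; congr (_ * F _); apply/val_inj. Qed.

Lemma sum_ord2 (S : nmodType) (F : 'I_2 -> S) : \sum_i F i = F 0 + F 1.
Proof. by rewrite big_ord_recl big_ord1; congr (_ + F _); apply/val_inj. Qed.

Lemma tnth2 T (a b : T) i : tnth [tuple a; b] i = xy a b i.
Proof. by case: (ord2P i) => ->. Qed.

Section Curves.
Variable K : numFieldType.
Implicit Types (h P : {mpoly K[2]}) (F G p q : {poly K}) (a b : K).

Definition on_curve F G h : {poly K} := mmap polyC (xy F G) h.

HB.instance Definition _ F G :=
  GRing.RMorphism.copy (on_curve F G) (mmap polyC (xy F G)).

Lemma poly_ext p q : (forall x, p.[x] = q.[x]) -> p = q.
Proof.
move=> pq; apply/eqP; rewrite -subr_eq0; apply/eqP/poly_eval0 => x.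
by rewrite hornerD hornerN pq subrr.
Qed.

Lemma mpoly_ext (f g : {mpoly K[2]}) :
  (forall a b, f.@[xy a b] = g.@[xy a b]) -> f = g.
Proof.
move=> fg; apply/eqP; rewrite -subr_eq0; apply/eqP/mpoly2_eval0 => v.
rewrite mevalB; apply/eqP; rewrite subr_eq0; apply/eqP.
rewrite -!(@meval_eq _ _ (xy (v 0 0) (v 0 1))) // => i;
by case: (ord2P i) => ->.
Qed.

Lemma on_curveE F G h t : (on_curve F G h).[t] = h.@[xy F.[t] G.[t]].
Proof.
rewrite /on_curve /mmap mevalE horner_sum; apply: eq_bigr => m _.
by rewrite hornerM hornerC /mmap1 !prod_ord2 hornerM !horner_exp.
Qed.

Lemma lineE a b h : on_curve (a *: 'X) (b *: 'X) h =
  \sum_(m <- msupp h) (h@_m * (a ^+ m 0 * b ^+ m 1)) *: 'X^(mdeg m).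
Proof.
apply: eq_bigr => m _; rewrite /mmap1 prod_ord2 mdegE sum_ord2 /=.
rewrite !exprZn -scalerAl -scalerAr mul_polyC -scalerAr -exprD !scalerA.
by congr (_ *: _); ring.
Qed.

Lemma size_line a b h :
  (size (on_curve (a *: 'X) (b *: 'X) h) <= msize h)%N.
Proof.
rewrite lineE big_seq; apply: leq_trans (size_sum _ _ _) _.
apply/bigmax_leqP_seq => m _ mh.
by apply: leq_trans (size_scale_leq _ _) _; rewrite size_polyXn msize_mdeg_lt.
Qed.

(** The homogeneous part of degree d of h at (a, b) is the coefficient of t^d
    in h(at, bt). This reduces all statements on leading forms to univariate
    polynomials along a line through the origin. *)
Lemma line_coef a b h d : (on_curve (a *: 'X) (b *: 'X) h)`_d =
  (pihomog mdeg d h).@[xy a b].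
Proof.
rewrite lineE coef_sum pihomogE raddf_sum /= [RHS]big_mkcond /=.
apply: eq_bigr => m _; rewrite coefZ coefXn eq_sym.
case: eqP => _; last by rewrite mulr0.
by rewrite mulr1 mevalZ mevalX prod_ord2.
Qed.

Lemma msize_leP h d :
  reflect (forall m, m \in msupp h -> (mdeg m < d)%N) (msize h <= d)%N.
Proof.
rewrite msizeE; apply: (iffP (bigmax_leqP_seq _ _ _ _)) => H m.
  by move/H; apply.
by move=> mh _; apply: H.
Qed.

Lemma pihomog_coef h d m :
  (pihomog mdeg d h)@_m = if mdeg m == d then h@_m else 0.
Proof.
rewrite pihomogE raddf_sum /= (eq_bigr (fun i => h@_i * (i == m)%:R)); last first.
  by move=> i _; rewrite mcoeffZ mcoeffX.
have [mh|mh] := boolP (m \in msupp h); last first.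
  rewrite (memN_msupp_eq0 mh) if_same big1_seq // => i /andP[_ ih].
  by case: eqP ih => [->|]; rewrite ?mulr0 // (negPf mh).
rewrite big_mkcond (bigD1_seq m) //= eqxx mulr1 big1 ?addr0 // => i /negPf ->.
by rewrite mulr0 if_same.
Qed.

Lemma msize_pihomog0 h d :
  (msize h <= d.+1)%N -> pihomog mdeg d h = 0 -> (msize h <= d)%N.
Proof.
move=> /msize_leP hd h0; apply/msize_leP => m mh.
have := hd m mh; rewrite ltnS leq_eqVlt => /orP[/eqP md|//].
have := pihomog_coef h d m; rewrite h0 mcoeff0 md eqxx => /esym/eqP.
by rewrite mcoeff_eq0 mh.
Qed.

Lemma msize_deriv h i : (msize h^`M(i) <= (msize h).-1)%N.
Proof.
apply/msize_leP => m; rewrite mcoeff_msupp mcoeff_deriv => mh.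
have: (m + U_(i))%MM \in msupp h.
  by rewrite mcoeff_msupp; apply: contraNneq mh => ->; rewrite mul0rn.
by move/msize_mdeg_lt; rewrite mdegD mdeg1 addn1; case: (msize h).
Qed.

Lemma msizeM_leq h P : (msize (h * P) <= (msize h + msize P).-1)%N.
Proof.
have [->|h0] := eqVneq h 0; first by rewrite mul0r msize0.
have [->|P0] := eqVneq P 0; first by rewrite mulr0 msize0.
by rewrite msizeM.
Qed.

(** The Jacobian determinant of (h, P), also the value at P of the derivation
    attached to h. *)
Definition bracket h P := h^`M(0) * P^`M(1) - h^`M(1) * P^`M(0).

(** Iterating the derivation of f on P(f, g), where bracket f g is constant,
    therefore produces the iterated partial derivatives of P in its second
    variable, evaluated at (f, g). *)
Lemma bracket_comp f g P :
  bracket f (P \mPo [tuple f; g]) =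
  (P^`M(1) \mPo [tuple f; g]) * bracket f g.
Proof.
rewrite /bracket !mderiv_comp !sum_ord2 !tnth2 /xy /=.
set p0 := comp_mpoly _ _; set p1 := comp_mpoly _ _.
move: p0 p1 (f^`M(0)) (f^`M(1)) (g^`M(0)) (g^`M(1)) => p0 p1 f0 f1 g0 g1.
by ring.
Qed.

(** Since msize is the degree plus one, the second part says that bracketing
    with f raises the degree by at most deg f - 2. *)
Lemma msize_bracket f g : bracket f g != 0 ->
  [/\ (2 <= msize f)%N, (2 <= msize g)%N &
    (msize (bracket f g) + 3 <= msize f + msize g)%N].
Proof.
have bd i j : (msize (f^`M(i) * g^`M(j)) <= ((msize f).-1 + (msize g).-1).-1)%N.
  apply: leq_trans (msizeM_leq _ _) _; have := msize_deriv f i.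
  have := msize_deriv g j; lia.
have d0 h i : (msize h <= 1)%N -> h^`M(i) = 0.
  by move/msize1_polyC => ->; rewrite mderivC.
move=> nz; have fge : (2 <= msize f)%N.
  by rewrite ltnNge; apply: contraNN nz => f1; rewrite /bracket !(d0 f) // !mul0r subrr.
have gge : (2 <= msize g)%N.
  by rewrite ltnNge; apply: contraNN nz => f1; rewrite /bracket !(d0 g) // !mulr0 subrr.
split => //.
suff: (msize (bracket f g) <= ((msize f).-1 + (msize g).-1).-1)%N by lia.
by apply: leq_trans (msizeD_le _ _) _; rewrite geq_max msizeN !bd.
Qed.

(** The derivation of f sends the k-th derivative of P at (f, g) to the next
    one up to a nonzero scalar, and each application raises the degree by at
    most deg f - 2. *)
Lemma msize_deriv_comp f g P c k : c != 0 -> bracket f g = c%:MP ->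
  P^`M(1, k) \mPo [tuple f; g] != 0 ->
  (msize (P^`M(1%R, k) \mPo [tuple f; g]) + 2 * k <=
    msize (P \mPo [tuple f; g]) + k * (msize f).-1)%N.
Proof.
move=> c0 fgc; elim: k => [|k IHk]; first by rewrite mderivn0; lia.
rewrite mderivnS => nz; set h := P^`M(1, k) in nz IHk *.
have eqb : bracket f (h \mPo [tuple f; g]) = c *: (h^`M(1) \mPo [tuple f; g]).
  by rewrite bracket_comp fgc mulrC mul_mpolyC.
have nz1 : h \mPo [tuple f; g] != 0.
  apply: contraNneq nz => h0; have := eqb; rewrite h0 /bracket !mderiv0 !mulr0 subrr.
  by move/esym/eqP; rewrite scaler_eq0 (negPf c0).
have nzb : bracket f (h \mPo [tuple f; g]) != 0.
  by rewrite eqb scaler_eq0 negb_or c0.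
have [] := msize_bracket nzb; have := IHk nz1; rewrite eqb msizeZ // !mulSn.
by move: (mmeasure _ _) (mmeasure _ _) (mmeasure _ _) (mmeasure _ _); lia.
Qed.
End Curves.

(** * Leading weighted forms *)

Section TopCoefficients.
Variable K : idomainType.
Implicit Types p q : {poly K}.

Lemma coefM_top p q a b : (size p <= a.+1)%N -> (size q <= b.+1)%N ->
  (p * q)`_(a + b) = p`_a * q`_b.
Proof.
move=> pa qb; rewrite coefM.
have la : (a < (a + b).+1)%N by rewrite ltnS leq_addr.
rewrite (bigD1 (Ordinal la)) //= addKn big1 ?addr0 // => i /eqP ne.
have [ia|ai|ia] := ltngtP (i : nat) a.
- by rewrite [q`__]nth_default ?mulr0 //; apply: leq_trans qb _; lia.
- by rewrite nth_default ?mul0r //; apply: leq_trans pa _.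
- by case: ne; apply/val_inj.
Qed.

Lemma coefX_top p a k : (size p <= a.+1)%N ->
  (size (p ^+ k) <= (a * k).+1)%N /\ (p ^+ k)`_(a * k) = p`_a ^+ k.
Proof.
move=> pa; have sz k' : (size (p ^+ k') <= (a * k').+1)%N.
  by apply: leq_trans (size_poly_exp_leq _ _) _; rewrite ltnS leq_mul2r; lia.
split=> //; elim: k => [|k IHk]; first by rewrite muln0 !expr0 coefC.
by rewrite !exprS mulnS coefM_top // IHk.
Qed.

(** An order of vanishing k is detected by the k-th derivative; this is used
    to read off a nonzero coefficient in wform_estimate. *)
Lemma derivn_mul_expXsubC k x q :
  (('X - x%:P) ^+ k * q)^`(k).[x] = q.[x] *+ k`!.
Proof.
elim: k q => [|k IHk] q; first by rewrite expr0 mul1r derivn0.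
rewrite derivSn derivM deriv_exp derivXsubC mul1r.
have -> : ('X - x%:P) ^+ k *+ k.+1 * q + ('X - x%:P) ^+ k.+1 * q^`() =
    ('X - x%:P) ^+ k * (q *+ k.+1 + ('X - x%:P) * q^`()).
  by rewrite exprS mulrnAl mulrDr mulrnAr; congr (_ + _); ring.
by rewrite IHk !hornerE subrr mul0r addr0 hornerMn factS mulrnA.
Qed.

End TopCoefficients.

Lemma nontrivial_root_of_unity (K : numClosedFieldType) k : (1 < k)%N ->
  exists2 z : K, z != 1 & z ^+ k = 1.
Proof.
move=> k1; pose s : {poly K} := \poly_(i < k) 1.
have ss : size s = k by rewrite size_poly_eq ?oner_neq0.
have /closed_rootP[z /eqP sz] : size s != 1%N by rewrite ss; apply: contraTneq k1 => ->.
have sE x : s.[x] = \sum_(i < k) x ^+ i.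
  by rewrite horner_poly; apply: eq_bigr => i _; rewrite mul1r.
exists z; last by apply/eqP; rewrite -subr_eq0 subrX1 -sE sz mulr0.
apply: contra_eq_neq sz => ->; rewrite sE.
rewrite (eq_bigr (fun=> 1)) => [|i _]; last by rewrite expr1n.
by rewrite sumr_const card_ord pnatr_eq0 -lt0n ltnW.
Qed.

Section WeightedForms.
Variable K : numFieldType.
Implicit Types (P : {mpoly K[2]}) (F G : {poly K}) (e : 'X_{1..2}).
Variables n m : nat.

(** The weight that gives degree n to the first variable and degree m to the
    second. *)
Definition wt e : nat := (n * e 0%R + m * e 1%R)%N.

Definition wdeg P : nat := \max_(e <- msupp P) wt e.

(** The leading weighted form of P with a put in place of its first variable,
    as a polynomial in the second one. If f and g have degrees n and m and
    leading coefficients a and b along a line, then its value at b is the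
    coefficient of t^(wdeg P) in P(f, g). *)
Definition wform P (a : K) : {poly K} :=
  \sum_(e <- msupp P | wt e == wdeg P) (P@_e * a ^+ e 0) *: 'X^(e 1).

Lemma wt_leq P e : e \in msupp P -> (wt e <= wdeg P)%N.
Proof. by move=> eP; apply: leq_bigmax_seq. Qed.

Lemma on_curveX F G e : on_curve F G 'X_[e] = F ^+ e 0 * G ^+ e 1.
Proof. by rewrite /on_curve mmapX /mmap1 prod_ord2. Qed.

Lemma on_curveZ F G c P : on_curve F G (c *: P) = c *: on_curve F G P.
Proof. by rewrite /on_curve mmapZ mul_polyC. Qed.

Lemma on_curve_comp (f g P : {mpoly K[2]}) F G :
  on_curve F G (P \mPo [tuple f; g]) =
  on_curve (on_curve F G f) (on_curve F G g) P.
Proof.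
apply: poly_ext => t; rewrite !on_curveE comp_mpoly_meval.
apply: meval_eq => i; rewrite tnth2 /xy.
by case: ifP.
Qed.

(** A monomial of weight D contributes at most weight D - k m after k
    derivations in the second variable, and only the monomials of maximal
    weight reach this bound; their leading coefficients assemble into the k-th
    derivative of the form. *)
Lemma wform_derivn P F G k : (size F <= n.+1)%N -> (size G <= m.+1)%N ->
  (k * m <= wdeg P)%N ->
  (on_curve F G P^`M(1%R, k))`_(wdeg P - k * m) = (wform P F`_n)^`(k).[G`_m].
Proof.
move=> sF sG kD; rewrite mderivnE raddf_sum coef_sum.
rewrite /wform raddf_sum /= horner_sum [RHS]big_mkcond /= big_seq [RHS]big_seq.
apply: eq_bigr => e /wt_leq; rewrite on_curveZ on_curveX coefZ.
rewrite derivnZ derivnXn hornerZ hornerMn hornerXn.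
have -> : (e - U_(1%R) *+ k)%MM 0%R = e 0 by rewrite mnmBE mulmnE mnm1E /= mul0n subn0.
have -> : (e - U_(1%R) *+ k)%MM 1%R = (e 1%R - k)%N by rewrite mnmBE mulmnE mnm1E /= mul1n.
have [ke|ek] := leqP k (e 1); last first.
  by rewrite ffact_small // mul0r mul0r mulr0n mulr0 if_same.
have [sF' cF] := coefX_top (e 0) sF; have [sG' cG] := coefX_top (e 1%R - k)%N sG.
have kem : (k * m <= m * e 1%R)%N by rewrite mulnC leq_mul2l ke orbT.
case: eqP => [eD|/eqP neD] le_eD.
  have -> : (wdeg P - k * m = n * e 0%R + m * (e 1%R - k))%N.
    by rewrite -eD /wt mulnBr (mulnC k) addnBA // mulnC.
  by rewrite coefM_top // cF cG -mulr_natr; ring.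
rewrite nth_default ?mulr0 //.
have ltD : (wt e < wdeg P)%N by rewrite ltn_neqAle neD.
apply: leq_trans (size_polyMleq _ _) _.
have aux a b x y : (a <= x.+1 -> b <= y.+1 -> (a + b).-1 <= (x + y).+1)%N by lia.
apply: leq_trans (aux _ _ _ _ sF' sG') _.
move: ltD; rewrite /wt mulnBr => ltD; move: kem ltD; rewrite (mulnC k m).
by move: (m * e 1%R)%N (n * e 0%R)%N (m * k)%N; lia.
Qed.

Lemma wdeg_attained P : P != 0 -> exists2 e, e \in msupp P & wt e = wdeg P.
Proof.
rewrite -msupp_eq0 /wdeg; elim: (msupp P) => // e [|e' r] IH _.
  by exists e; rewrite ?inE // big_seq1.
have [e1 e1r e1E] := IH isT; rewrite big_cons -e1E.
case: (leqP (wt e1) (wt e)) => _; first by exists e; rewrite ?inE ?eqxx.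
by exists e1; rewrite // inE e1r orbT.
Qed.

(** The weight is fixed, so the exponent of the second variable determines
    that of the first, and no two monomials of the form collide. *)
Lemma wform_coef P a e : (0 < n)%N -> e \in msupp P -> wt e = wdeg P ->
  (wform P a)`_(e 1) = P@_e * a ^+ e 0.
Proof.
move=> n0 eP eD; rewrite coef_sum big_mkcond (bigD1_seq e) //= eD eqxx.
rewrite coefZ coefXn eqxx mulr1 big1 ?addr0 // => e' ne; case: eqP => // e'D.
rewrite coefZ coefXn; case: eqP => [e1|]; last by rewrite mulr0.
case/eqP: ne; apply/mnmP => i; case: (ord2P i) => -> //.
move: e'D; rewrite -eD /wt e1 => /eqP; rewrite eqn_add2r eqn_pmul2l //.
by move/eqP.
Qed.

Lemma wform_neq0 P a : (0 < n)%N -> a != 0 -> P != 0 -> wform P a != 0.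
Proof.
move=> n0 a0 /wdeg_attained[e eP eD]; apply/eqP => /(congr1 (coefp (e 1))) /=.
move/eqP; rewrite coef0 wform_coef // mulf_eq0 expf_eq0 (negPf a0) andbF orbF.
by rewrite mcoeff_eq0 eP.
Qed.

Lemma size_wform P a : (m * (size (wform P a)).-1 <= wdeg P)%N.
Proof.
have [->|nz] := eqVneq (wform P a) 0; first by rewrite size_poly0 muln0.
have [e eP eE] : exists2 e, e \in msupp P & e 1 = (size (wform P a)).-1.
  have : lead_coef (wform P a) != 0 by rewrite lead_coef_eq0.
  rewrite lead_coefE; set j := _.-1 => jnz.
  have [/hasP[e eP /eqP eE]|/hasPn H] := boolP (has (fun e => e 1 == j) (msupp P)).
    by exists e.
  case/eqP: jnz; rewrite coef_sum big_seq_cond big1 // => e /andP[eP _].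
  by rewrite coefZ coefXn eq_sym (negPf (H e eP)) mulr0.
by rewrite -eE; apply: leq_trans (wt_leq eP); rewrite leq_addl.
Qed.
End WeightedForms.

(** * The degree estimate *)

Section DegreeEstimate.
Variable K : numFieldType.
Implicit Types (f g P : {mpoly K[2]}) (a b c : K).

(** Degree estimate. Along the line through (a, b), let u and v be the leading
    coefficients of f and g, and let k be the multiplicity of v as a root of
    the leading form of P. The k-th derivative of P at (f, g) has degree at
    least wdeg P - k m, because the leading coefficient is the nonzero value
    of the k-th derivative of the form at v, and degree at most 1 + k (n - 2),
    because it comes from a variable by k applications of the derivation of f.
    *)
Lemma wform_estimate f g P i c a b (n := (msize f).-1) (m := (msize g).-1)
    (u := (pihomog mdeg n f).@[xy a b]) (v := (pihomog mdeg m g).@[xy a b]) :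
  c != 0 -> bracket f g = c%:MP -> P \mPo [tuple f; g] = 'X_i -> u != 0 ->
  exists k q, wform n m P u = ('X - v%:P) ^+ k * q /\
    (wdeg n m P + 2 * k <= 1 + k * (n + m))%N.
Proof.
move=> c0 fgc PX u0.
have nzfg : bracket f g != 0 by rewrite fgc mpolyC_eq0.
have [f2 g2 _] := msize_bracket nzfg.
have n0 : (0 < n)%N by rewrite /n; lia.
have m0 : (0 < m)%N by rewrite /m; lia.
have P0 : P != 0.
  apply: contra_eq_neq PX => ->; rewrite comp_mpoly0 eq_sym -msize_poly_eq0.
  by rewrite msizeX mdeg1.
have Q0 := wform_neq0 m n0 u0 P0.
have [k [q qv Qq]] := multiplicity_XsubC (wform n m P u) v.
rewrite Q0 /= in qv.
have kD : (k * m <= wdeg n m P)%N.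
  apply: leq_trans (size_wform n m P u); rewrite mulnC leq_pmul2l // Qq.
  have q0 : (0 < size q)%N.
    by rewrite size_poly_gt0; apply: contraNneq qv => ->; rewrite root0.
  rewrite size_Mmonic ?monic_exp ?monicXsubC -?size_poly_gt0 // size_exp_XsubC.
  by rewrite -(prednK q0) addnS leq_addl.
exists k, q; split; first by rewrite mulrC.
pose L h := on_curve (a *: 'X) (b *: 'X) h.
have szL (h : {mpoly K[2]}) : (size (L h) <= (msize h).-1.+1)%N.
  by apply: leq_trans (size_line _ _ _) _; case: (mmeasure _ _).
have := wform_derivn (szL f) (szL g) kD.
rewrite !line_coef -/n -/m -/u -/v Qq mulrC derivn_mul_expXsubC.
rewrite -on_curve_comp => coefE; have nz : q.[v] *+ k`! != 0.
  by rewrite mulrn_eq0 negb_or -lt0n fact_gt0.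
set h := _ \mPo _ in coefE; have lt_h : (wdeg n m P - k * m < msize h)%N.
  apply: leq_trans (size_line a b h).
  by rewrite ltnNge; apply: contra nz => le; rewrite -coefE nth_default.
have h0 : h != 0 by rewrite -msize_poly_eq0 -lt0n; apply: leq_trans lt_h.
have := msize_deriv_comp c0 fgc h0; rewrite -/h PX msizeX mdeg1 -/n.
by move: lt_h kD; rewrite mulnDr; move: (k * n)%N (k * m)%N; lia.
Qed.

End DegreeEstimate.

Section DoubleRoots.
Variable K : numClosedFieldType.
Implicit Types (f g P : {mpoly K[2]}) (a b c u v z : K).

(** The exponents of the second variable in a weighted homogeneous form are
    congruent modulo n / gcd(n, m), so the form is multiplied by a constant
    under rotation by a root of unity of that order. *)
Lemma wform_comp_root_of_unity n m P a z : (0 < n)%N ->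
  z ^+ (n %/ gcdn n m) = 1 ->
  exists2 s, s != 0 & wform n m P a \Po (z *: 'X) = s *: wform n m P a.
Proof.
move=> n0 z1; have g0 : (0 < gcdn n m)%N by rewrite gcdn_gt0 n0.
have p0 : (0 < n %/ gcdn n m)%N by rewrite divn_gt0 // dvdn_leq // dvdn_gcdl.
have z0 : z != 0.
  apply: contra_eq_neq z1 => ->; rewrite expr0n eqn0Ngt p0 /=.
  by rewrite eq_sym oner_neq0.
have [->|P0] := eqVneq P 0.
  exists 1; first exact: oner_neq0.
  by rewrite /wform msupp0 big_nil comp_poly0 scaler0.
have [e0 _ e0D] := wdeg_attained n m P0.
exists (z ^+ e0 1); first by rewrite expf_neq0.
rewrite /wform raddf_sum scaler_sumr /=; apply: eq_bigr => e /eqP eD.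
rewrite comp_polyZ comp_Xn_poly exprZn !scalerA mulrC; congr (_ * _ *: _).
suff /eqP eqj : e 1 == e0 1 %[mod n %/ gcdn n m].
  by rewrite -(expr_mod (e 1) z1) eqj expr_mod.
have dv : n = (n %/ gcdn n m * gcdn n m)%N by rewrite divnK ?dvdn_gcdl.
have dw : m = (m %/ gcdn n m * gcdn n m)%N by rewrite divnK ?dvdn_gcdr.
have cop : coprime (n %/ gcdn n m) (m %/ gcdn n m).
  rewrite /coprime -(eqn_pmul2r g0) muln_gcdl -dv -dw mul1n //.
have: (n %/ gcdn n m * e 0%R + m %/ gcdn n m * e 1%R =
       n %/ gcdn n m * e0 0%R + m %/ gcdn n m * e0 1%R)%N.
  apply/eqP; rewrite -(eqn_pmul2r g0) !mulnDl ![(_ * _ * gcdn n m)%N]mulnAC.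
  by rewrite -dv -dw -/(wt n m e) -/(wt n m e0) eD e0D.
move: (_ %/ _)%N (_ %/ _)%N cop {dv dw g0 p0 z1} => m' n' cop eqw.
wlog le : e e0 eqw {eD e0D} / (e 1%R <= e0 1%R)%N.
  move=> H; case: (leqP (e 1%R) (e0 1%R)) => [/H|/ltnW le]; first exact.
  by rewrite eq_sym; apply: H.
rewrite eq_sym eqn_mod_dvd // -(Gauss_dvdr _ cop) mulnBr.
have -> : (m' * e0 1%R - m' * e 1%R = n' * (e 0%R - e0 0%R))%N.
  rewrite mulnBr; move: eqw (leq_mul (leqnn m') le).
  by move: (n' * _)%N (n' * _)%N (m' * _)%N (m' * _)%N; lia.
exact: dvdn_mulr.
Qed.

(** If n does not divide m, the rotation by a nontrivial root of unity moves
    the root v to a second root of the same multiplicity. *)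
Lemma double_root n m P u v k q : (0 < n)%N -> ~~ (n %| m)%N -> v != 0 ->
  wform n m P u != 0 ->
  wform n m P u = ('X - v%:P) ^+ k * q -> (2 * k <= (size (wform n m P u)).-1)%N.
Proof.
move=> n0 nm v0; set Q := wform _ _ _ _ => Q0 Qq.
have p1 : (1 < n %/ gcdn n m)%N.
  have g0 : (0 < gcdn n m)%N by rewrite gcdn_gt0 n0.
  rewrite ltn_neqAle divn_gt0 // (dvdn_leq _ (dvdn_gcdl _ _)) // andbT eq_sym.
  apply: contra nm => /eqP E; have := divnK (dvdn_gcdl n m); rewrite E mul1n.
  by move=> <-; apply: dvdn_gcdr.
have [z z1 zp] := nontrivial_root_of_unity K p1.
have [s s0 Qs] := wform_comp_root_of_unity P u n0 zp; rewrite -/Q in Qs.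
have z0 : z != 0.
  apply: contra_eq_neq zp => ->; rewrite expr0n eqn0Ngt (ltnW p1) /=.
  by rewrite eq_sym oner_neq0.
have dv1 : ('X - v%:P) ^+ k %| Q by rewrite Qq dvdp_mulr.
have dv2 : ('X - (z^-1 * v)%:P) ^+ k %| Q.
  have : ('X - v%:P) ^+ k \Po (z *: 'X) %| Q.
    by rewrite -(dvdpZr _ _ s0) -Qs Qq comp_polyM dvdp_mulr.
  rewrite (rmorphXn (comp_poly _)) /= comp_polyB comp_polyX comp_polyC.
  have -> : z *: 'X - v%:P = z *: ('X - (z^-1 * v)%:P).
    by rewrite scalerBr -mul_polyC -[in RHS]mul_polyC -polyCM mulrA divff // mul1r.
  by rewrite exprZn dvdpZl ?expf_neq0.
have cop : coprimep (('X - v%:P) ^+ k) (('X - (z^-1 * v)%:P) ^+ k).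
  rewrite coprimep_expl // coprimep_expr // coprimep_XsubC2 //.
  rewrite subr_eq0; apply: contra z1 => /eqP E.
  by rewrite -invr_eq1; apply/eqP/(mulIf v0); rewrite E mul1r.
have := dvdp_leq Q0 (_ : ('X - v%:P) ^+ k * ('X - (z^-1 * v)%:P) ^+ k %| Q).
rewrite Gauss_dvdp // dv1 dv2 => /(_ isT).
rewrite size_Mmonic ?monic_exp ?monicXsubC // ?expf_neq0 ?polyXsubC_eq0 //.
by rewrite !size_exp_XsubC; move: (size _) => d; clear; lia.
Qed.
End DoubleRoots.

(** * Reduction of degrees *)

Lemma mderivXU (K : numFieldType) (i j : 'I_2) :
  ('X_i : {mpoly K[2]})^`M(j) = (i == j)%:R.
Proof.
rewrite mderivX mnm1E; case: eqP => [->|_]; last by rewrite scale0r.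
by rewrite scale1r -[X in (X - _)%MM]add0m addmK mpolyX0.
Qed.

Lemma pihomogXn (K : numFieldType) (f : {mpoly K[2]}) n s : (msize f <= n.+1)%N ->
  pihomog mdeg (n * s)%N (f ^+ s) = pihomog mdeg n f ^+ s.
Proof.
move=> fn; apply: mpoly_ext => a b; rewrite rmorphXn /=.
rewrite -(line_coef a b f n) -(line_coef a b (f ^+ s) (n * s)) rmorphXn /=.
case: (@coefX_top _ (on_curve (a *: 'X) (b *: 'X) f) n s) => //.
exact: leq_trans (size_line _ _ _) fn.
Qed.

Section DegreeReduction.
Variable K : numClosedFieldType.
Implicit Types (f g P : {mpoly K[2]}) (a b c u v z : K).

(** With k the multiplicity of v, the estimate gives wdeg P + 2 k <= 1 + k (n
    + m). Hence k = 0 is impossible when wdeg P > 1. If n did not divide m,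
    two roots of multiplicity k would give wdeg P >= 2 k m, which contradicts
    n <= m. *)
Lemma wform_root f g P i c a b (n := (msize f).-1) (m := (msize g).-1)
    (u := (pihomog mdeg n f).@[xy a b]) (v := (pihomog mdeg m g).@[xy a b]) :
  c != 0 -> bracket f g = c%:MP -> P \mPo [tuple f; g] = 'X_i ->
  (n <= m)%N -> u != 0 -> v != 0 -> (1 < wdeg n m P)%N ->
  (n %| m)%N /\ root (wform n m P u) v.
Proof.
move=> c0 fgc PX le_nm u0 v0 D2.
have nzfg : bracket f g != 0 by rewrite fgc mpolyC_eq0.
have [f2 g2 _] := msize_bracket nzfg.
have n0 : (0 < n)%N by rewrite -ltnS prednK ?(ltnW f2).
have P0 : P != 0.
  by apply: contraTneq D2 => ->; rewrite /wdeg msupp0 big_nil.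
have Q0 := wform_neq0 m n0 u0 P0.
have [k [q [Qq leD]]] := wform_estimate c0 fgc PX u0.
rewrite -/n -/m -/u -/v in Qq leD.
have k0 : (0 < k)%N.
  by rewrite lt0n; apply: contraTneq leD => ->; rewrite mul0n muln0 -ltnNge; lia.
split; last by rewrite Qq rootM -(prednK k0) root_exp_XsubC eqxx.
have [//|ndv] := boolP (n %| m)%N.
have := double_root n0 ndv v0 Q0 Qq; rewrite -(leq_pmul2l (leq_trans n0 le_nm)).
move/leq_trans => /(_ _ (size_wform n m P u)) le2.
by clear -le2 leD le_nm k0; nia.
Qed.

(** If both components of the inverse had weighted degree at most 1 < m, they
    would not involve g, so both coordinates would be polynomials in f alone
    and the Jacobian would vanish. *)
Lemma wdeg_gt1 f g (P : 'I_2 -> {mpoly K[2]}) c n m : c != 0 ->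
  bracket f g = c%:MP -> (forall i, P i \mPo [tuple f; g] = 'X_i) ->
  (1 < m)%N -> exists i, (1 < wdeg n m (P i))%N.
Proof.
move=> c0 fgc PX m1.
have key i : (wdeg n m (P i) <= 1)%N -> bracket f 'X_i = 0.
  move=> D1; rewrite -PX bracket_comp.
  suff -> : (P i)^`M(1) = 0 by rewrite comp_mpoly0 mul0r.
  apply/mpolyP => e; rewrite mcoeff_deriv mcoeff0.
  have [|/memN_msupp_eq0 -> //] := boolP ((e + U_(1))%MM \in msupp (P i)).
    move/(@wt_leq _ n m) => le; have := leq_trans le D1.
    by rewrite /wt [X in (_ + _ * X)%N]mnmDE mnm1E /=; move: m1; clear; nia.
  by rewrite mul0rn.
have [//|/forallNP noD] := pselect (exists i, (1 < wdeg n m (P i))%N).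
have D1 i : (wdeg n m (P i) <= 1)%N by rewrite leqNgt; apply/negP/noD.
have := key 0 (D1 0); have := key 1 (D1 1).
rewrite /bracket !mderivXU /= !(mulr0, mulr1, subr0, add0r, sub0r) => f0 /eqP.
rewrite oppr_eq0 => /eqP f1; move: fgc; rewrite /bracket f0 f1 !mul0r subr0.
by move/esym/eqP; rewrite mpolyC_eq0 (negPf c0).
Qed.

(** At a generic point the value of the leading form of g divided by the s-th
    power of that of f, with s = m / n, is one of the finitely many roots of a
    fixed univariate polynomial. The product of the polynomials gl - r fl^s
    over these roots r thus vanishes identically, so one factor does, and that
    multiple of f^s cancels the leading form of g. *)
Lemma degree_reduction f g (P : 'I_2 -> {mpoly K[2]}) c : c != 0 ->
  bracket f g = c%:MP -> (forall i, P i \mPo [tuple f; g] = 'X_i) ->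
  (msize f <= msize g)%N -> (2 < msize g)%N ->
  exists a s, (msize (g - a *: f ^+ s) < msize g)%N.
Proof.
move=> c0 fgc PX le_fg g3.
have nzfg : bracket f g != 0 by rewrite fgc mpolyC_eq0.
have [f2 g2 _] := msize_bracket nzfg.
pose n := (msize f).-1; pose m := (msize g).-1.
have fn : msize f = n.+1 by rewrite prednK // ltnW.
have gm : msize g = m.+1 by rewrite prednK // ltnW.
have [i D2] : exists i, (1 < wdeg n m (P i))%N.
  by apply: wdeg_gt1 c0 fgc PX _; rewrite -ltnS -gm.
have n0 : (0 < n)%N by rewrite -ltnS -fn.
have P0 : P i != 0.
  by apply: contraTneq D2 => ->; rewrite /wdeg msupp0 big_nil.
pose fl := pihomog mdeg n f; pose gl := pihomog mdeg m g.
have top0 (h : {mpoly K[2]}) d : msize h = d.+1 -> pihomog mdeg d h != 0.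
  by move=> hd; apply/eqP => /(msize_pihomog0 (eq_leq hd)); rewrite hd ltnn.
have fl0 : fl != 0 := top0 _ _ fn; have gl0 : gl != 0 := top0 _ _ gm.
have rt a b : fl.@[xy a b] != 0 -> gl.@[xy a b] != 0 ->
    (n %| m)%N /\ root (wform n m (P i) fl.@[xy a b]) gl.@[xy a b].
  by move=> fa ga; apply: (wform_root c0 fgc (PX i)) => //; rewrite -ltnS -fn -gm.
have /dvdnP[s ms] : (n %| m)%N.
  have [//|nd] := boolP (n %| m)%N.
  have : fl * gl = 0.
    apply: mpoly_ext => a b; rewrite mevalM meval0; apply/eqP; rewrite mulf_eq0.
    have [//|fa] := eqVneq fl.@[xy a b] 0; have [//|ga /=] := eqVneq gl.@[xy a b] 0.
    by have [] := rt _ _ fa ga; rewrite (negPf nd).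
  by move/eqP; rewrite mulf_eq0 (negPf fl0) (negPf gl0).
pose R := wform n m (P i) 1.
have R0 : R != 0 by rewrite wform_neq0 ?oner_neq0.
(* at a generic point, v / u ^+ s is a root of R *)
have rtR a b : fl.@[xy a b] != 0 -> gl.@[xy a b] != 0 ->
    root R (gl.@[xy a b] / fl.@[xy a b] ^+ s).
  move=> fa ga; have [_ /eqP Q0] := rt _ _ fa ga.
  move: Q0 fa ga; move: fl.@[_] gl.@[_] => u v Q0 u0 v0.
  have [e0 _ e0D] := wdeg_attained n m P0.
  have: u ^+ (e0 0%R + s * e0 1%R)%N * R.[v / u ^+ s] = 0.
    rewrite -[RHS]Q0 /R /wform !horner_sum mulr_sumr; apply: eq_bigr => e /eqP eD.
    have -> : (e0 0%R + s * e0 1%R = e 0%R + s * e 1%R)%N.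
      apply/eqP; rewrite -(eqn_pmul2l n0) !mulnDr !mulnA (mulnC n s) -ms.
      by rewrite -/(wt n m e0) -/(wt n m e) eD e0D.
    rewrite !hornerZ !hornerXn expr1n mulr1 exprMn exprVn -exprM exprD.
    have : u ^+ (s * e 1%R) != 0 by rewrite expf_neq0.
    by move: (u ^+ (s * _)%N) => w w0; field.
  by move/eqP; rewrite mulf_eq0 expf_eq0 (negPf u0) andbF.
(* The factors fl and gl take care of the points that are not generic. *)
have [rs Rrs] := closed_field_poly_normal R.
have: fl * gl * \prod_(r <- rs) (gl - r *: fl ^+ s) = 0.
  apply: mpoly_ext => a b; rewrite !mevalM meval0; apply/eqP; rewrite !mulf_eq0.
  have [//|fa] := eqVneq fl.@[xy a b] 0; have [//|ga /=] := eqVneq gl.@[xy a b] 0.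
  have := rtR _ _ fa ga; rewrite Rrs rootZ ?lead_coef_eq0 // root_prod_XsubC.
  move=> rin; rewrite rmorph_prod /= (big_rem _ rin) /= mulf_eq0; apply/orP; left.
  by rewrite mevalB mevalZ rmorphXn /= divfK ?subrr // expf_neq0.
move/eqP; rewrite !mulf_eq0 (negPf fl0) (negPf gl0) /= prodf_seq_eq0.
case/hasP=> r _ /= /eqP E; exists r, s; rewrite gm ltnS.
apply: msize_pihomog0.
  apply: leq_trans (msizeD_le _ _) _; rewrite geq_max gm leqnn msizeN.
  apply: leq_trans (msizeZ_le _ _) _.
  have le : (msize (f ^+ s) <= (n * s).+1)%N.
    elim: s {ms rtR E} => [|s IHs]; first by rewrite expr0 msize1.
    rewrite exprS; apply: leq_trans (msizeM_leq _ _) _; rewrite fn mulnS.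
    by move: IHs; clear; move: (mmeasure _ _) => d; lia.
  by rewrite ms mulnC.
have pE : pihomog mdeg m (f ^+ s) = fl ^+ s by rewrite ms mulnC pihomogXn // fn.
by rewrite linearB linearZ /= pE.
Qed.
End DegreeReduction.

(** * Special automorphisms of the plane *)

Section Slices.
Variable K : numFieldType.
Implicit Types (h k : {mpoly K[2]}) (F G p q : {poly K}) (a b : K).

Lemma deriv_on_curve F G h : (on_curve F G h)^`() =
  on_curve F G h^`M(0) * F^`() + on_curve F G h^`M(1) * G^`().
Proof.
elim/mpolyind: h => [|c e p _ _ IH].
  by rewrite !mderiv0 /on_curve !mmap0 !mul0r addr0 derivC.
rewrite !mderivD !mderivZ !mderivX /on_curve !mmapD -!/(on_curve F G _).
rewrite !on_curveZ !on_curveX derivD derivZ IH derivM !deriv_exp.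
rewrite !mnmBE !mnm1E /= !subn0 !subn1 !scaler_nat -!mul_polyC.
by ring.
Qed.

Lemma deriv_const p a : p^`() = a%:P -> p = a *: 'X + (p.[0])%:P.
Proof.
move=> pa; apply/polyP => -[|i]; rewrite coefD coefZ coefX coefC /=.
  by rewrite mulr0 add0r horner_coef0.
have := congr1 (fun q : {poly K} => q`_i) pa; rewrite /= coef_deriv coefC.
case: i => [|i] /=; first by rewrite mulr1n mulr1 addr0.
by move/eqP; rewrite mulrn_eq0 /= => /eqP ->; rewrite mulr0 addr0.
Qed.

Lemma bracket_eval h k a b : (bracket h k).@[xy a b] =
  h^`M(0).@[xy a b] * k^`M(1).@[xy a b] - h^`M(1).@[xy a b] * k^`M(0).@[xy a b].
Proof. by rewrite /bracket mevalB !mevalM. Qed.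

(** Partial derivatives are ordinary derivatives along horizontal and vertical
    slices. *)
Lemma meval_dx h a b :
  h^`M(0).@[xy a b] = ((on_curve 'X b%:P h)^`()).[a].
Proof.
by rewrite deriv_on_curve derivX derivC mulr1 mulr0 addr0 on_curveE hornerX hornerC.
Qed.

Lemma meval_dy h a b :
  h^`M(1).@[xy a b] = ((on_curve a%:P 'X h)^`()).[b].
Proof.
by rewrite deriv_on_curve derivX derivC mulr1 mulr0 add0r on_curveE hornerX hornerC.
Qed.

Definition lift_y p : {mpoly K[2]} := \sum_(i < size p) p`_i *: 'X_1 ^+ i.

Lemma lift_yE p a b : (lift_y p).@[xy a b] = p.[b].
Proof.
rewrite rmorph_sum horner_coef /=; apply: eq_bigr => i _.
by rewrite mevalZ rmorphXn /= mevalXU.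
Qed.

Lemma lift_y_dx p : (lift_y p)^`M(0) = 0.
Proof.
apply: mpoly_ext => a b; rewrite meval_dx meval0.
rewrite (_ : on_curve _ _ _ = p.[b]%:P) ?derivC ?horner0 //.
by apply: poly_ext => t; rewrite on_curveE hornerX !hornerC lift_yE.
Qed.

Lemma bracket_tri a p b : a != 0 ->
  bracket (a *: 'X_0 + lift_y p) (a^-1 *: 'X_1 + b%:MP) = 1.
Proof.
move=> a0; rewrite /bracket !mderivD !mderivZ !mderivXU lift_y_dx !mderivC /=.
rewrite !addr0 !mulr1n !mulr0n !scaler0 mulr0 subr0.
by rewrite -scalerAl -scalerAr mul1r scalerA divff // scale1r.
Qed.

Lemma bracket_turn : bracket (- 'X_1 : {mpoly K[2]}) 'X_0 = 1.
Proof.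
by rewrite /bracket !mderivN !mderivXU /=; ring.
Qed.
End Slices.

Lemma det_mx2 (S : comPzRingType) (A : 'M[S]_2) :
  \det A = A 0 0 * A 1 1 - A 0 1 * A 1 0.
Proof.
rewrite (expand_det_row _ 0) big_ord_recl big_ord1 /cofactor !det_mx11 !mxE /=.
rewrite expr0 mul1r expr1 mulN1r mulrN.
by congr (A _ _ * A _ _ - A _ _ * A _ _); apply/val_inj.
Qed.

Section SpecialAutomorphisms.
Variable R : realType.
Local Notation C := R[i].
Local Notation G := (SAutC2 R).
Implicit Types (f g h : G) (x y a b c : C) (p q : {poly C}).

Definition pt x y : 'rV[C]_2 := \row_i xy x y i.

Lemma pt0 x y : (pt x y) 0 0 = x. Proof. by rewrite mxE. Qed.
Lemma pt1 x y : (pt x y) 0 1 = y. Proof. by rewrite mxE. Qed.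

Lemma pt_eta (v : 'rV[C]_2) : pt (v 0 0) (v 0 1) = v.
Proof. by apply/rowP => i; rewrite mxE; case: (ord2P i) => ->. Qed.

Lemma pt_inj x y x' y' : pt x y = pt x' y' -> x = x' /\ y = y'.
Proof.
by move=> e; rewrite -(pt0 x y) -{2}(pt1 x y) e pt0 pt1.
Qed.

Lemma saut_ext f g : (forall x y, f (pt x y) = g (pt x y)) -> f = g.
Proof.
by move=> fg; apply/val_inj/funext => v /=; rewrite -(pt_eta v) fg.
Qed.

Lemma sautM f g v : (f * g)%g v = f (g v). Proof. by []. Qed.
Lemma saut1 v : (1%g : G) v = v. Proof. by []. Qed.
Lemma sautK f v : (f^-1)%g (f v) = v. Proof. by rewrite -sautM mulVg. Qed.

Definition polypair (F0 F1 : {mpoly C[2]}) : 'rV[{mpoly C[2]}]_2 := \row_i xy F0 F1 i.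

Lemma polymap_pt F0 F1 x y :
  polymap (polypair F0 F1) (pt x y) = pt F0.@[xy x y] F1.@[xy x y].
Proof.
apply/rowP => i; rewrite !mxE; have E (P : {mpoly C[2]}) :
  P.@[(pt x y) 0] = P.@[xy x y] by apply: meval_eq => j; rewrite mxE.
by case: (ord2P i) => -> /=; rewrite E.
Qed.

Lemma det_jacobian2 F0 F1 : \det (jacobian (polypair F0 F1)) = bracket F0 F1.
Proof. by rewrite det_mx2 !mxE. Qed.

Lemma special_polyaut_pair F0 F1 G0 G1 :
  (forall x y, let x' := F0.@[xy x y] in let y' := F1.@[xy x y] in
     G0.@[xy x' y'] = x /\ G1.@[xy x' y'] = y) ->
  (forall x y, let x' := G0.@[xy x y] in let y' := G1.@[xy x y] in
     F0.@[xy x' y'] = x /\ F1.@[xy x' y'] = y) ->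
  bracket F0 F1 = 1 -> special_polyaut (polymap (polypair F0 F1)).
Proof.
move=> FG GF br; exists (polypair F0 F1); split; [by []| |by rewrite det_jacobian2].
exists (polypair G0 G1); split=> v; rewrite -(pt_eta v) !polymap_pt.
  by have [-> ->] := FG (v 0 0) (v 0 1).
by have [-> ->] := GF (v 0 0) (v 0 1).
Qed.

(** The inverse, known as a map, gives a polynomial identity because the base
    field is infinite. *)
Lemma saut_polys f : exists F0 F1, [/\ saut_fun f = polymap (polypair F0 F1),
  bracket F0 F1 = 1 &
  exists P : 'I_2 -> {mpoly C[2]}, forall i, P i \mPo [tuple F0; F1] = 'X_i].
Proof.
have [F [fF [H [HF FH]] detF]] := saut_funP f.
have FE : F = polypair (F 0 0) (F 0 1).
  by apply/rowP => i; rewrite mxE; case: (ord2P i) => ->.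
exists (F 0 0), (F 0 1); rewrite -FE; split; rewrite -?det_jacobian2 -?FE //.
have HFX : poly_comp H F = poly_id C 2.
  apply: polymap_inj; rewrite polymap_comp polymap_id.
  by apply/funext => v /=; rewrite -fF HF.
have tE : [tuple F 0 0; F 0 1] = [tuple F 0 j | j < 2].
  by apply: eq_from_tnth => j; rewrite tnth_mktuple tnth2; case: (ord2P j) => ->.
exists (H 0) => i; rewrite tE.
by have := congr1 (fun M : 'rV_2 => M 0 i) HFX; rewrite !mxE.
Qed.

Definition tri_map a p b :=
  polymap (polypair (a *: 'X_0 + lift_y p) (a^-1 *: 'X_1 + b%:MP)).

Lemma tri_mapE a p b x y :
  tri_map a p b (pt x y) = pt (a * x + p.[y]) (a^-1 * y + b).
Proof. by rewrite /tri_map polymap_pt !mevalD !mevalZ lift_yE mevalC !mevalXU. Qed.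

Lemma tri_special a p b : a != 0 -> special_polyaut (tri_map a p b).
Proof.
move=> a0; pose q := - a^-1 *: (p \Po (a *: ('X - b%:P))).
apply: (special_polyaut_pair (G0 := a^-1 *: 'X_0 + lift_y q)
  (G1 := a *: 'X_1 + (- (a * b))%:MP)).
- move=> x y /=; rewrite !mevalD !mevalZ !lift_yE !mevalC !mevalXU /xy /=.
  rewrite /q !hornerE horner_comp !hornerE addrK mulrA divff // mul1r.
  by split; field.
- move=> x y /=; rewrite !mevalD !mevalZ !lift_yE !mevalC !mevalXU /xy /=.
  rewrite /q !hornerE horner_comp !hornerE mulrBr.
  by split; field.
- exact: bracket_tri.
Qed.

Lemma tri_exists a p b : {t : G | a != 0 ->
  forall x y, t (pt x y) = pt (a * x + p.[y]) (a^-1 * y + b)}.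
Proof.
have [->|a0] := eqVneq a 0; first by exists 1%g.
by exists (MkSAutC2 (asboolT (tri_special p b a0))) => _ x y; apply: tri_mapE.
Qed.

(** The triangular automorphism (x, y) |-> (a x + p(y), y / a + b), for a
    nonzero; an arbitrary automorphism for a = 0. It is an opaque witness, so
    that reasoning goes through its values at points only. *)
Definition tri a p b : G := sval (tri_exists a p b).

Lemma triE a p b x y : a != 0 ->
  tri a p b (pt x y) = pt (a * x + p.[y]) (a^-1 * y + b).
Proof. by move=> a0; apply: (svalP (tri_exists a p b)). Qed.

Definition shear p : G := tri 1 p 0.

Lemma shearE p x y : shear p (pt x y) = pt (x + p.[y]) y.
Proof. by rewrite triE ?oner_neq0 // invr1 !mul1r addr0. Qed.

Definition turn_map := polymap (polypair (- 'X_1 : {mpoly C[2]}) 'X_0).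

Lemma turn_exists : {t : G | forall x y, t (pt x y) = pt (- y) x}.
Proof.
have turn_sp : special_polyaut turn_map.
  apply: (special_polyaut_pair (G0 := 'X_1) (G1 := - 'X_0)).
  - by move=> u v /=; rewrite !mevalN !mevalXU /xy /= opprK.
  - by move=> u v /=; rewrite !mevalN !mevalXU /xy /= opprK.
  - exact: bracket_turn.
exists (MkSAutC2 (asboolT turn_sp)) => x y.
by rewrite /= /turn_map polymap_pt mevalN !mevalXU.
Qed.

(** The rotation (x, y) |-> (- y, x), which exchanges the roles of the two
    coordinates under conjugation. *)
Definition turn : G := sval turn_exists.

Lemma turnE x y : turn (pt x y) = pt (- y) x.
Proof. exact: (svalP turn_exists). Qed.
End SpecialAutomorphisms.

(** * Generation by shears and the quarter turn *)

Section AffineComponents.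
Variable K : numFieldType.
Implicit Types (h k : {mpoly K[2]}) (p q : {poly K}) (a b : K).

Lemma msize_affine h : (msize h <= 2)%N ->
  exists a b c, [/\ h^`M(0) = a%:MP, h^`M(1) = b%:MP &
    forall x y, h.@[xy x y] = a * x + b * y + c].
Proof.
move=> h2.
have dC i : exists c, h^`M(i) = c%:MP.
  exists (h^`M(i))@_0; apply: msize1_polyC.
  by apply: leq_trans (msize_deriv _ _) _; case: (mmeasure _ _) h2 => [|[|[]]].
have [[a ha] [b hb]] := (dC 0, dC 1); exists a, b, h.@[xy 0 0]; split=> // x y.
have /deriv_const/(congr1 (horner^~ x)) : (on_curve 'X y%:P h)^`() = a%:P.
  by rewrite deriv_on_curve derivX derivC ha mulr1 mulr0 addr0 /on_curve mmapC.
rewrite /= !hornerE !on_curveE hornerX !hornerC => ->; rewrite -addrA; congr (_ + _).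
have /deriv_const/(congr1 (horner^~ y)) : (on_curve 0%:P 'X h)^`() = b%:P.
  by rewrite deriv_on_curve derivX derivC hb mulr1 mulr0 add0r /on_curve mmapC.
by rewrite /= !hornerE !on_curveE !hornerX !hornerC.
Qed.
End AffineComponents.

Section Generation.
Variable R : realType.
Local Notation C := R[i].
Local Notation G := (SAutC2 R).
Local Notation shear := (@shear R).
Local Notation tri := (@tri R).
Local Notation turn := (turn R).
Implicit Types (f g h : G) (x y a b c d : C) (p q : {poly C}).

Lemma turnVE x y : (turn^-1)%g (pt x y) = pt y (- x).
Proof. by rewrite -[pt x y](_ : turn (pt y (- x)) = _) ?sautK // turnE opprK. Qed.

Lemma shearM p q : shear (p + q) = (shear p * shear q)%g.
Proof.
apply: saut_ext => x y; rewrite sautM !shearE hornerD; congr pt.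
by rewrite -addrA [q.[_] + _]addrC.
Qed.

Lemma shear0 : shear 0 = 1%g.
Proof. by apply: saut_ext => x y; rewrite shearE horner0 addr0. Qed.

Lemma shearN p : shear (- p) = (shear p)^-1%g.
Proof. by apply: (mulgI (shear p)); rewrite -shearM subrr mulgV shear0. Qed.

Lemma lshear_exists q : {t : G | t = turn * shear (q \Po - 'X) * turn^-1}%g.
Proof. by eexists. Qed.

(** The shear (x, y) |-> (x, y + q(x)), the conjugate of a shear by the
    quarter turn. *)
Definition lshear q : G := sval (lshear_exists q).

Lemma lshear_turn q : lshear q = (turn * shear (q \Po - 'X) * turn^-1)%g.
Proof. exact: (svalP (lshear_exists q)). Qed.

Lemma lshearE q x y : lshear q (pt x y) = pt x (y + q.[x]).
Proof.
by rewrite lshear_turn !sautM turnVE shearE turnE horner_comp !hornerE !opprK.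
Qed.

(** Bruhat decomposition of the linear part, with the translation distributed
    over the outer shears. *)
Lemma affine_factor f a b c d e e' : a * d - b * c = 1 -> c != 0 ->
  (forall x y, f (pt x y) = pt (a * x + b * y + e) (c * x + d * y + e')) ->
  f = (shear (((a - 1) / c) *: 'X + (e - (a - 1) / c * e')%:P) *
       lshear (c *: 'X + e'%:P) * shear (((d - 1) / c) *: 'X))%g.
Proof.
move=> det c0 fE; apply: saut_ext => x y; rewrite !sautM fE shearE lshearE shearE.
have bE : b = (a * d - 1) / c by rewrite -det; field.
by rewrite !(hornerD, hornerZ, hornerX, hornerC); congr pt; rewrite ?bE; field.
Qed.

Section Induction.
Variable P : G -> Prop.
Hypothesis PM : forall f g, P f -> P g -> P (f * g)%g.
Hypothesis Pshear : forall p, P (shear p).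
Hypothesis Pturn : P turn.

Lemma gen_turnV : P (turn^-1)%g.
Proof.
rewrite (_ : turn^-1 = turn * turn * turn)%g; first by do !apply: PM.
apply: saut_ext => x y; rewrite turnVE !sautM !turnE.
by rewrite opprK.
Qed.

Lemma gen_lshear q : P (lshear q).
Proof. by rewrite lshear_turn; do !apply: PM => //; apply: gen_turnV. Qed.

Lemma gen_turnl f : P (turn * f)%g -> P f.
Proof. by move=> Pf; rewrite -(mulKg turn f); apply: PM => //; apply: gen_turnV. Qed.

Lemma gen_affine f a b c d e e' : a * d - b * c = 1 ->
  (forall x y, f (pt x y) = pt (a * x + b * y + e) (c * x + d * y + e')) ->
  P f.
Proof.
have main (k : G) a1 b1 c1 d1 e1 e1' : a1 * d1 - b1 * c1 = 1 -> c1 != 0 ->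
    (forall x y, k (pt x y) = pt (a1 * x + b1 * y + e1) (c1 * x + d1 * y + e1')) ->
    P k.
  move=> det c0 kE; rewrite (affine_factor det c0 kE).
  by apply: PM => //; apply: PM => //; apply: gen_lshear.
move=> det fE; have [c0|c0] := eqVneq c 0; last exact: main det c0 fE.
apply: gen_turnl; apply: (main _ (- c) (- d) a b (- e') e).
- by rewrite -det; ring.
- by apply: contra_eq_neq det => ->; rewrite c0 mulr0 mul0r subrr eq_sym oner_neq0.
- by move=> x y; rewrite sautM fE turnE; congr pt; ring.
Qed.

(** Jung's theorem: shears and the quarter turn generate the group. By
    induction on the sum of the degrees of the two components: the larger
    degree is lowered by degree_reduction, that is, by composing with a shear,
    after a quarter turn if the first component is the larger one. *)
Lemma jung_generation f : P f.
Proof.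
have [F0 [F1 [fF _ _]]] := saut_polys f.
have [N le] := ubnP (msize F0 + msize F1); elim: N f F0 F1 fF le => // N IH.
have main f F0 F1 : saut_fun f = polymap (polypair F0 F1) ->
    (msize F0 <= msize F1)%N -> (msize F0 + msize F1 < N.+1)%N -> P f.
  move=> fF le01 leN; have [F0' [F1' [fF' br [Q QX]]]] := saut_polys f.
  have eqF : polypair F0 F1 = polypair F0' F1' by apply: polymap_inj; rewrite -fF -fF'.
  have e0 : F0' = F0 by have := congr1 (fun M : 'rV_2 => M 0 0) eqF; rewrite !mxE.
  have e1 : F1' = F1 by have := congr1 (fun M : 'rV_2 => M 0 1) eqF; rewrite !mxE.
  rewrite {}e0 {}e1 {eqF fF'} in br QX.
  have [aff|big] := leqP (msize F1) 2.
    have [a [b [e [ha hb hE]]]] := msize_affine (leq_trans le01 aff).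
    have [c [d [e' [hc hd hE']]]] := msize_affine aff.
    apply: (@gen_affine f a b c d e e'); last first.
      by move=> x y; rewrite fF polymap_pt hE hE'.
    have := bracket_eval F0 F1 0 0; rewrite br ha hb hc hd meval1 !mevalC.
    by move/esym.
  have br' : bracket F0 F1 = 1%:MP by rewrite br.
  have [a [s lt]] := degree_reduction (oner_neq0 C) br' QX le01 big.
  pose q := a *: 'X^s; have fE : (f = lshear q * (lshear (- q) * f))%g.
    rewrite mulgA [X in (X * f)%g](_ : _ = 1%g) ?mul1g //.
    by apply: saut_ext => x y; rewrite sautM !lshearE hornerN subrK.
  rewrite fE; apply: PM; first exact: gen_lshear.
  apply: (IH _ F0 (F1 - a *: F0 ^+ s)).
    apply/funext => v; rewrite -(pt_eta v) /= -[X in X = _]/((lshear (- q)) _).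
    rewrite fF !polymap_pt lshearE mevalB mevalZ rmorphXn /=.
    by rewrite hornerN hornerZ hornerXn.
  by rewrite -ltnS; apply: leq_trans leN; rewrite ltnS ltn_add2l.
move=> f F0 F1 fF leN.
have [le01|/ltnW le10] := leqP (msize F0) (msize F1); first exact: main fF le01 leN.
apply: gen_turnl; apply: (main _ (- F1) F0).
- apply/funext => v; rewrite -(pt_eta v) /= -[X in X = _]/(turn _).
  by rewrite fF !polymap_pt turnE mevalN.
- by rewrite msizeN.
- by rewrite msizeN addnC.
Qed.
End Induction.
End Generation.

(** * Growth of degrees along curves *)

Section FiberedComponents.
Variable K : numFieldType.
Implicit Types (p q : {poly K}) (a b c : K).

(** If k depends on y only, then the Jacobian is h_x k_y = 1; so k_y divides 1
    and is a nonzero constant, and then h_x is constant too. *)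
Lemma fibered_components (h k : {mpoly K[2]}) : bracket h k = 1 ->
  (forall a b, k.@[xy a b] = k.@[xy 0 b]) ->
  exists c p e, [/\ c != 0, forall a b, h.@[xy a b] = c * a + p.[b] &
    forall a b, k.@[xy a b] = c^-1 * b + e].
Proof.
move=> br kE; pose q := on_curve 0%:P 'X k.
have qE a b : k.@[xy a b] = q.[b] by rewrite kE on_curveE hornerC hornerX.
have kx a b : k^`M(0).@[xy a b] = 0.
  rewrite meval_dx (_ : on_curve 'X b%:P k = (q.[b])%:P) ?derivC ?horner0 //.
  by apply: poly_ext => t; rewrite on_curveE hornerX !hornerC qE.
have ky a b : k^`M(1).@[xy a b] = q^`().[b].
  rewrite meval_dy; congr (_^`()).[_].
  by apply: poly_ext => t; rewrite on_curveE hornerX !hornerC qE.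
have hx a b : h^`M(0).@[xy a b] * q^`().[b] = 1.
  have := congr1 (meval (xy a b)) br.
  by rewrite bracket_eval kx mulr0 subr0 meval1 ky.
have /size_poly1P[c c0 qc] : size q^`() == 1%N.
  have rq : on_curve 0%:P 'X h^`M(0) * q^`() = 1.
    by apply: poly_ext => t; rewrite hornerM on_curveE !hornerC hornerX hx.
  have /eqP := congr1 (fun r : {poly K} => size r) rq.
  rewrite size_poly1 size_mul_eq1 => /andP[_]; exact.
have hE a b : h.@[xy a b] = c^-1 * a + h.@[xy 0 b].
  have /deriv_const/(congr1 (horner^~ a)) : (on_curve 'X b%:P h)^`() = c^-1%:P.
    apply: poly_ext => t; rewrite -meval_dx hornerC; apply: (mulIf c0).
    by rewrite mulVf // -(hx t b) qc hornerC.
  by rewrite /= !(hornerD, hornerZ, hornerX, hornerC) !on_curveE !hornerX !hornerC.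
exists c^-1, (on_curve 0%:P 'X h), q.[0]; split; first by rewrite invr_eq0.
  by move=> a b; rewrite hE on_curveE hornerC hornerX.
move=> a b; rewrite qE (deriv_const qc) invrK.
by rewrite !(hornerD, hornerZ, hornerX, hornerC) mulr0 add0r.
Qed.
End FiberedComponents.

Section CurveDegrees.
Variable R : realType.
Local Notation C := R[i].
Local Notation G := (SAutC2 R).
Local Notation shear := (@shear R).
Local Notation tri := (@tri R).
Local Notation turn := (turn R).
Implicit Types (f g h : G) (x y a b c : C) (p q F : {poly C}).

(** Preserving the set of horizontal lines; by fibered_tri these are the
    triangular automorphisms. *)
Definition fibered f := forall x x' y, (f (pt x y)) 0 1 = (f (pt x' y)) 0 1.

Definition affine f := exists a b c d e e', forall x y,
  f (pt x y) = pt (a * x + b * y + e) (c * x + d * y + e').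

Lemma fibered_tri f : fibered f -> exists a p b, a != 0 /\ f = tri a p b.
Proof.
move=> fE; have [F0 [F1 [fF br _]]] := saut_polys f.
have F1E a b : F1.@[xy a b] = F1.@[xy 0 b].
  by have := fE a 0 b; rewrite fF !polymap_pt !pt1.
have [c [p [b [c0 F0l F1l]]]] := fibered_components br F1E.
exists c, p, b; split=> //; apply: saut_ext => x y.
by rewrite fF polymap_pt triE // F0l F1l.
Qed.

Lemma tri_fibered a p b : a != 0 -> fibered (tri a p b).
Proof. by move=> a0 x x' y; rewrite !triE // !pt1. Qed.

Lemma shear_fibered p : fibered (shear p).
Proof. exact/tri_fibered/oner_neq0. Qed.

Lemma turn_affine : affine turn.
Proof.
by exists 0, (-1), 1, 0, 0, 0 => x y; rewrite turnE; congr pt; ring.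
Qed.

Lemma fiberedM f g : fibered f -> fibered g -> fibered (f * g)%g.
Proof.
move=> fE gE x x' y; rewrite !sautM -(pt_eta (g (pt x y))) -(pt_eta (g (pt x' y))).
by rewrite (gE x x' y); apply: fE.
Qed.

Lemma affineM f g : affine f -> affine g -> affine (f * g)%g.
Proof.
move=> [a [b [c [d [e [e' fE]]]]]] [a1 [b1 [c1 [d1 [e1 [e1' gE]]]]]].
exists (a * a1 + b * c1), (a * b1 + b * d1), (c * a1 + d * c1), (c * b1 + d * d1),
  (a * e1 + b * e1' + e), (c * e1 + d * e1' + e') => x y.
by rewrite sautM gE fE; congr pt; ring.
Qed.

Definition maps_curve f F1 F2 G1 G2 :=
  forall t, f (pt F1.[t] F2.[t]) = pt G1.[t] G2.[t].

Lemma maps_curve_inj f F1 F2 G1 G2 G1' G2' :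
  maps_curve f F1 F2 G1 G2 -> maps_curve f F1 F2 G1' G2' -> G1 = G1' /\ G2 = G2'.
Proof.
move=> m m'; split; apply: poly_ext => t;
by have := m t; rewrite m' => /pt_inj[].
Qed.

Lemma maps_curveM f g F1 F2 G1 G2 H1 H2 : maps_curve g F1 F2 G1 G2 ->
  maps_curve f G1 G2 H1 H2 -> maps_curve (f * g)%g F1 F2 H1 H2.
Proof. by move=> mg mf t; rewrite sautM mg mf. Qed.

Definition deg_le (N : nat) F1 F2 := (size F1 <= N.+1)%N /\ (size F2 <= N.+1)%N.

Definition deg_bound (d : nat) f := forall F1 F2, exists G1 G2,
  maps_curve f F1 F2 G1 G2 /\ (forall N, deg_le N F1 F2 -> deg_le (d * N) G1 G2).

(** The image curve is required to be again dominated by its first component,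
    so that the property passes to products. The condition 1 < size F1 excludes
    constant curves, for which degrees carry no information. *)
Definition deg_mult (d : nat) f := deg_bound d f /\
  forall F1 F2 G1 G2, maps_curve f F1 F2 G1 G2 ->
    (1 < size F1)%N -> (size F2 < size F1)%N ->
    (size G2 < size G1)%N /\ size G1 = (d * (size F1).-1).+1.

Lemma deg_bound_exists f : exists d, deg_bound d f.
Proof.
have [F0 [F1 [fF _ _]]] := saut_polys f.
have sz (h : {mpoly C[2]}) (A B : {poly C}) N : deg_le N A B ->
    (size (on_curve A B h) <= (msize h * N).+1)%N.
  move=> [AN BN]; rewrite /on_curve /mmap big_seq; apply: leq_trans (size_sum _ _ _) _.
  apply/bigmax_leqP_seq => e _ /msize_mdeg_lt le_e; rewrite mul_polyC.
  apply: leq_trans (size_scale_leq _ _) _.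
  rewrite /mmap1 prod_ord2 /=; apply: leq_trans (size_polyMleq _ _) _.
  have [sA _] := coefX_top (e 0) AN; have [sB _] := coefX_top (e 1) BN.
  have aux u v z t : (u <= z.+1 -> v <= t.+1 -> (u + v).-1 <= (z + t).+1)%N by lia.
  apply: leq_trans (aux _ _ _ _ sA sB) _; rewrite ltnS -mulnDr mulnC leq_mul2r.
  by apply/orP; right; apply: leq_trans (ltnW le_e); rewrite mdegE sum_ord2.
exists (msize F0 + msize F1)%N => A B; exists (on_curve A B F0), (on_curve A B F1).
split=> [t|N AB]; first by rewrite fF polymap_pt !on_curveE.
split; [apply: leq_trans (sz F0 _ _ _ AB) _|apply: leq_trans (sz F1 _ _ _ AB) _];
by rewrite ltnS leq_mul2r ?leq_addr ?leq_addl orbT.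
Qed.

Lemma deg_boundM d d' f g :
  deg_bound d f -> deg_bound d' g -> deg_bound (d * d') (f * g)%g.
Proof.
move=> bf bg F1 F2; have [G1 [G2 [mg sg]]] := bg F1 F2.
have [H1 [H2 [mf sf]]] := bf G1 G2; exists H1, H2; split.
  exact: maps_curveM mg mf.
by move=> N FN; rewrite -mulnA; exact: sf (sg _ FN).
Qed.

Lemma deg_multM d d' f g : (0 < d')%N ->
  deg_mult d f -> deg_mult d' g -> deg_mult (d * d') (f * g)%g.
Proof.
move=> d'0 [bf mf] [bg mg]; split; first exact: deg_boundM.
move=> F1 F2 H1 H2 mfg s1 s12; have [G1 [G2 [mg' _]]] := bg F1 F2.
have [lG sG] := mg _ _ _ _ mg' s1 s12.
have mf' : maps_curve f G1 G2 H1 H2 by move=> t; rewrite -mg' -mfg.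
have sG1 : (1 < size G1)%N by rewrite sG ltnS muln_gt0 d'0 -ltnS prednK // ltnW.
have [lH sH] := mf _ _ _ _ mf' sG1 lG.
by split=> //; rewrite sH sG /= mulnA.
Qed.

Lemma deg_multX d f k : (0 < d)%N -> deg_mult d f -> deg_mult (d ^ k) (f ^+ k)%g.
Proof.
move=> d0 df; elim: k => [|k IH]; last first.
  by rewrite expnS expgS; apply: deg_multM; rewrite ?expn_gt0 ?d0.
rewrite expn0 expg0; split.
  by move=> F1 F2; exists F1, F2; split=> [t|N]; rewrite ?mul1n.
move=> F1 F2 G1 G2 m s1 s12.
have [//|-> ->] := @maps_curve_inj _ _ _ _ _ F1 F2 m.
by split=> //; rewrite mul1n prednK // ltnW.
Qed.

(** The affine factor makes the second component as large as the first one,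
    because it does not preserve horizontal lines; the triangular factor then
    inserts it into a polynomial p of degree d >= 2, because it is not affine.
    *)
Lemma deg_mult_tri_affine e f : fibered e -> ~ affine e -> affine f -> ~ fibered f ->
  exists2 d, (1 < d)%N & deg_mult d (e * f)%g.
Proof.
move=> /fibered_tri[a [p [b [a0 ->]]]] nA [a1 [b1 [c1 [d1 [e1 [e1' fE]]]]]] nE.
have c0 : c1 != 0.
  apply/eqP => c0; apply: nE => x x' y.
  by rewrite !fE !pt1 c0 !mul0r.
have p3 : (2 < size p)%N.
  rewrite ltnNge; apply/negP => p2; apply: nA.
  exists a, p`_1, 0, a^-1, p`_0, b => x y; rewrite triE //.
  rewrite (horner_coef_wide _ p2) !big_ord_recl big_ord0 /= expr0 expr1.
  by congr pt; ring.
exists (size p).-1; first by lia.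
pose M1 (F1 F2 : {poly C}) : {poly C} := a1 *: F1 + (b1 *: F2 + e1%:P).
pose M2 (F1 F2 : {poly C}) : {poly C} := c1 *: F1 + (d1 *: F2 + e1'%:P).
pose H1 F1 F2 : {poly C} := p \Po M2 F1 F2 + a *: M1 F1 F2.
pose H2 F1 F2 : {poly C} := a^-1 *: M2 F1 F2 + b%:P.
have mH F1 F2 : maps_curve (tri a p b * f)%g F1 F2 (H1 F1 F2) (H2 F1 F2).
  move=> t; rewrite sautM fE triE // /H1 /H2 /M1 /M2.
  rewrite !(hornerD, hornerZ, hornerC, horner_comp) !addrA.
  by congr pt; rewrite [LHS]addrC.
have szC (u : C) N : (size (u%:P) <= N.+1)%N.
  by apply: leq_trans (size_polyC_leq1 _) _.
have szM (u v w : C) F1 F2 N : deg_le N F1 F2 ->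
    (size (u *: F1 + (v *: F2 + w%:P))%R <= N.+1)%N.
  move=> [s1 s2]; apply: leq_trans (size_polyD _ _) _; rewrite geq_max.
  apply/andP; split; first exact: leq_trans (size_scale_leq _ _) s1.
  apply: leq_trans (size_polyD _ _) _; rewrite geq_max szC andbT.
  exact: leq_trans (size_scale_leq _ _) s2.
have d2 : (1 < (size p).-1)%N by lia.
move: ((size p).-1) (size_comp_poly_leq p) (size_comp_poly p) d2 => d compl comp d2.
split=> [F1 F2|F1 F2 G1 G2 mG s1 s12].
  exists (H1 F1 F2), (H2 F1 F2); split=> // N FN.
  have m1 := szM a1 b1 e1 _ _ _ FN; have m2 := szM c1 d1 e1' _ _ _ FN.
  have NdN : (N.+1 <= (d * N).+1)%N by rewrite ltnS leq_pmull // ltnW.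
  split; apply: leq_trans (size_polyD _ _) _; rewrite geq_max.
    apply/andP; split.
      apply: leq_trans (compl _) _; rewrite ltnS leq_mul2l; apply/orP; right.
      by move: m2; rewrite -/(M2 F1 F2); case: (size (M2 F1 F2)).
    by apply: leq_trans (size_scale_leq _ _) _; apply: leq_trans m1 _.
  rewrite szC andbT; apply: leq_trans (size_scale_leq _ _) _.
  exact: leq_trans m2 _.
have [-> ->] := maps_curve_inj mG (mH F1 F2).
set n := (size F1).-1; have F1n : size F1 = n.+1 by rewrite prednK // ltnW.
have n0 : (0 < n)%N by rewrite -ltnS -F1n.
have FN : deg_le n F1 F2 by split; rewrite -F1n // ltnW.
have sM2 : size (M2 F1 F2) = n.+1.
  rewrite size_polyDl size_scale // F1n; apply: leq_ltn_trans (size_polyD _ _) _.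
  rewrite gtn_max (leq_ltn_trans (size_polyC_leq1 _)) // andbT.
  by apply: leq_ltn_trans (size_scale_leq _ _) _; rewrite -F1n.
have scomp : size (p \Po M2 F1 F2) = (d * n).+1.
  have := comp (M2 F1 F2); rewrite sM2 /=; case: (size _) => [|s] /= sE.
    by have := muln_gt0 d n; rewrite -sE n0 (ltnW d2).
  by rewrite sE.
have lt : (n.+1 < (d * n).+1)%N by rewrite ltnS -[X in (X < _)%N]mul1n ltn_pmul2r.
have sH1 : size (H1 F1 F2) = (d * n).+1.
  rewrite size_polyDl scomp //; apply: leq_ltn_trans lt.
  by apply: leq_trans (size_scale_leq _ _) _; apply: szM.
split=> //; rewrite sH1; apply: leq_ltn_trans lt.
apply: leq_trans (size_polyD _ _) _; rewrite geq_max szC andbT.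
by apply: leq_trans (size_scale_leq _ _) _; rewrite sM2.
Qed.

(** The degree of f^(2k) along a suitable line is d^(2k), whereas conjugating
    f^k gives degree at most C d^k with C independent of k. *)
Lemma deg_mult_not_conj_square d f : (1 < d)%N -> deg_mult d f ->
  ~ exists h, (f ^+ 2 = f ^ h)%g.
Proof.
move=> d1 df [h fh]; have d0 := ltnW d1.
have [u hu] := deg_bound_exists (h^-1)%g; have [v hv] := deg_bound_exists h.
pose k := (u * v)%N.
(* Any k with C < d^k gives the contradiction; k = C suffices. *)
have fk : (f ^+ (2 * k) = h^-1 * (f ^+ k * h))%g by rewrite expgnA fh -conjXg.
have [_ lower] := deg_multX (2 * k) d0 df; have [up _] := deg_multX k d0 df.
have [G1 [G2 [m bd]]] := deg_boundM hu (deg_boundM up hv) 'X 0.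
rewrite -fk in m; have [||_ sG] := lower _ _ _ _ m; rewrite ?size_polyX ?size_poly0 //.
have [|+ _] := bd 1%N; first by split; rewrite ?size_polyX ?size_poly0.
rewrite sG size_polyX /= ltnS !muln1 mulnCA -/k mul2n -addnn expnD.
rewrite leq_pmul2l ?expn_gt0 ?d0 // => le.
by have := leq_trans (ltn_expl k d1) le; rewrite ltnn.
Qed.
End CurveDegrees.

(** * Conjugacy to triangular maps *)

Section Trichotomy.
Variable R : realType.
Local Notation C := R[i].
Local Notation G := (SAutC2 R).
Local Notation shear := (@shear R).
Local Notation tri := (@tri R).
Local Notation turn := (turn R).
Implicit Types (f g h : G) (x y a b c : C) (p q : {poly C}) (u v w : seq G).

Lemma lshearN q : lshear (- q) = (lshear q)^-1%g.
Proof.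
apply: (mulgI (lshear q)); rewrite mulgV; apply: saut_ext => x y.
by rewrite sautM !lshearE hornerN subrK.
Qed.

(** A linear map of the complex plane has an eigenvector. If it has the form
    (1, r), a lower shear moves it to the x-axis; the slope r is a root of the
    quadratic polynomial P below. If b = 0 the y-axis is invariant, and the
    quarter turn moves it to the x-axis. *)
Lemma affine_conj_fibered f : affine f -> exists h, fibered (f ^ h)%g.
Proof.
move=> [a [b [c [d [e [e' fE]]]]]].
have [b0|b0] := eqVneq b 0.
  exists turn => x x' y; rewrite conjgE !sautM !turnE !fE !turnVE !pt1 b0.
  by ring.
pose P : {poly C} := b *: 'X^2 + ((a - d) *: 'X + (- c)%:P).
have /closed_rootP[r /eqP Pr] : size P != 1%N.
  rewrite /P size_polyDl size_scale // size_polyXn //.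
  apply: leq_ltn_trans (size_polyD _ _) _; rewrite gtn_max.
  rewrite (leq_ltn_trans (size_scale_leq _ _)) ?size_polyX //.
  by rewrite (leq_ltn_trans (size_polyC_leq1 _)).
rewrite !(hornerD, hornerZ, hornerX, hornerXn, hornerC) in Pr.
exists (lshear (r *: 'X)) => x x' y; rewrite conjgE !sautM !lshearE !fE -lshearN !lshearE !pt1.
rewrite !(hornerN, hornerZ, hornerX).
have E z : c * z + d * (y + r * z) + e' - r * (a * z + b * (y + r * z) + e) =
  (d - r * b) * y + e' - r * e - (b * r ^+ 2 + ((a - d) * r - c)) * z by ring.
by rewrite !E Pr !mul0r.
Qed.

Definition word_prod w : G := foldr (fun f g => f * g)%g 1%g w.

Definition letters w := {in w, forall f, affine f \/ fibered f}.

Lemma word_prod_cat u v : word_prod (u ++ v) = (word_prod u * word_prod v)%g.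
Proof. by elim: u => [|f u IH] /=; rewrite ?mul1g // IH mulgA. Qed.

Lemma word_exists f : exists w, letters w /\ f = word_prod w.
Proof.
pose P f := exists w, letters w /\ f = word_prod w.
apply: (@jung_generation R P) => [g h [u [lu ->]] [v [lv ->]]|p|].
- exists (u ++ v); rewrite word_prod_cat; split=> // k.
  by rewrite mem_cat => /orP[/lu|/lv].
- exists [:: shear p]; rewrite /= mulg1; split=> // k; rewrite inE => /eqP ->.
  by right; apply: shear_fibered.
- exists [:: turn]; rewrite /= mulg1; split=> // k; rewrite inE => /eqP ->.
  by left; apply: turn_affine.
Qed.

(** Words that represent f up to conjugation, so that only the cyclic order of
    the letters matters. *)
Definition cyclic_word f w := letters w /\ exists h, (f ^ h)%g = word_prod w.

Lemma cyclic_word_rot f u v : cyclic_word f (u ++ v) -> cyclic_word f (v ++ u).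
Proof.
move=> [l [h fh]]; split=> [k|]; first by rewrite mem_cat orbC -mem_cat; apply: l.
exists (h * word_prod u)%g.
by rewrite conjgM fh conjgE !word_prod_cat !mulgA mulVg mul1g.
Qed.

Lemma cyclic_word_merge f (x y : G) w : affine x /\ affine y \/ fibered x /\ fibered y ->
  cyclic_word f (x :: y :: w) -> cyclic_word f ((x * y)%g :: w).
Proof.
move=> xy [l [h fh]]; split; last by exists h; rewrite fh /= mulgA.
move=> k; rewrite inE => /orP[/eqP->|kw]; last by apply: l; rewrite !inE kw !orbT.
by case: xy => [][xx yy]; [left; apply: affineM|right; apply: fiberedM].
Qed.

(** In a cyclic word of minimal length no two cyclically adjacent letters are
    both affine or both triangular, so the letters alternate and none of them
    belongs to both classes. Read from a triangular letter, the word is a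
    product of pairs to which deg_mult_tri_affine applies. *)
Lemma reduced_word_deg_mult f n : (1 < n)%N ->
  (forall w, cyclic_word f w -> (n <= size w)%N) ->
  forall w, cyclic_word f w -> size w = n -> fibered (head 1%g w) ->
  exists2 d, (1 < d)%N & deg_mult d (word_prod w).
Proof.
move=> n1 min.
have pair (x y : G) w : cyclic_word f (x :: y :: w) -> (size w).+2 = n ->
    ~ (affine x /\ affine y \/ fibered x /\ fibered y).
  by move=> cw sw /cyclic_word_merge/(_ cw)/min; rewrite -sw /= ltnn.
(* The word is cut as u ++ v and the induction runs over the final part v; u
   is kept because the minimality of the length concerns the whole word. *)
have main k v u : (size v <= k)%N -> cyclic_word f (u ++ v) -> size (u ++ v) = n ->
    fibered (head 1%g (u ++ v)) -> v != [::] -> fibered (head 1%g v) ->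
    exists2 d, (1 < d)%N & deg_mult d (word_prod v).
  elim: k v u => [|k IH] [|x [|y v]] u //= sv cw sw hE _ xE.
    (* A single last letter x would be cyclically adjacent to the first one,
       and both would be triangular. *)
    case: u cw sw hE => [|z u] cw sw hE; first by move: n1; rewrite -sw.
    case: (pair x z u); [exact: (cyclic_word_rot cw)| |by right].
    by rewrite -sw /= size_cat /= addn1.
  have cw' : cyclic_word f (x :: y :: (v ++ u)) := cyclic_word_rot cw.
  have sz : (size (v ++ u)).+2 = n by rewrite -sw !size_cat /= !addnS addnC.
  have nxy := pair _ _ _ cw' sz.
  have xnA : ~ affine x.
    move=> xA; have [yA|yE] : affine y \/ fibered y by apply: cw'.1; rewrite !inE eqxx orbT.
      by apply: nxy; left.
    by apply: nxy; right.
  have ynE : ~ fibered y by move=> yE; apply: nxy; right.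
  have yA : affine y.
    by have [//|/ynE] : affine y \/ fibered y by apply: cw'.1; rewrite !inE eqxx orbT.
  have [d d1 dxy] := deg_mult_tri_affine xE xnA yA ynE.
  case: v sv cw sw hE cw' sz => [|z v] sv cw sw hE cw' sz.
    by exists d; rewrite //= mulg1.
  have zE : fibered z.
    have [zA|//] : affine z \/ fibered z by apply: cw'.1; rewrite !inE eqxx !orbT.
    case: (pair y z ((v ++ u) ++ [:: x])); last by left.
      exact: (@cyclic_word_rot f [:: x] (y :: z :: (v ++ u)) cw').
    by rewrite size_cat addn1.
  have [d' d'1 dv] :
      exists2 d', (1 < d')%N & deg_mult d' (word_prod (z :: v)).
    by apply: (IH (z :: v) (u ++ [:: x; y])); rewrite -?catA //; apply: ltnW.
  exists (d * d')%N; last by rewrite mulgA; apply: deg_multM => //; apply: ltnW.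
  by apply: leq_trans d1 _; rewrite leq_pmulr // ltnW.
move=> w cw sw hE; apply: (main (size w) w [::]) => //.
by rewrite -size_eq0 sw -lt0n ltnW.
Qed.

(** A shortest cyclic word for f either has at most one letter or is covered by
    reduced_word_deg_mult. *)
Lemma trichotomy f : exists h,
  [\/ affine (f ^ h)%g, fibered (f ^ h)%g |
     exists2 d, (1 < d)%N & deg_mult d (f ^ h)%g].
Proof.
pose Q n := `[< exists w, size w = n /\ cyclic_word f w >].
have exQ : exists n, Q n.
  have [w [lw fw]] := word_exists f; exists (size w); apply/asboolP; exists w.
  by split=> //; split=> //; exists 1%g; rewrite conjg1.
case: (ex_minnP exQ) => n /asboolP[w [sw cw]] min.
have minw w' : cyclic_word f w' -> (n <= size w')%N.
  by move=> cw'; apply: min; apply/asboolP; exists w'.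
case: w sw cw => [|x [|y w]] sw cw.
- have [_ [h fh]] := cw; exists h; apply: Or32 => a b c.
  by rewrite fh !saut1 !pt1.
- have [l [h fh]] := cw; exists h; rewrite fh /= mulg1.
  have [xA|xE] : affine x \/ fibered x by apply: l; rewrite inE.
    exact: Or31.
  exact: Or32.
have n1 : (1 < n)%N by rewrite -sw.
have red := reduced_word_deg_mult n1 minw.
have fin w' : cyclic_word f w' -> size w' = n -> fibered (head 1%g w') ->
    exists h, [\/ affine (f ^ h)%g, fibered (f ^ h)%g |
     exists2 d, (1 < d)%N & deg_mult d (f ^ h)%g].
  move=> cw' sw' hE; have [_ [h fh]] := cw'; exists h; apply: Or33.
  by rewrite fh; apply: red.
have [xA|xE] : affine x \/ fibered x by apply: cw.1; rewrite inE eqxx.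
  have [yA|yE] : affine y \/ fibered y by apply: cw.1; rewrite !inE eqxx orbT.
    have /minw : cyclic_word f ((x * y)%g :: w) by apply: cyclic_word_merge cw; left.
    by rewrite -sw /= ltnn.
  apply: (fin ((y :: w) ++ [:: x])) => //; last by rewrite size_cat addn1.
  exact: (@cyclic_word_rot f [:: x]).
exact: (fin (x :: y :: w)).
Qed.

(** This is the only consequence of the trichotomy that the theorem needs:
    growth of degrees is incompatible with being conjugate to one's square. *)
Lemma conj_square_fibered f g : (f ^+ 2 = f ^ g)%g -> exists h, fibered (f ^ h)%g.
Proof.
move=> fg; have [h [fA|fE|[d d1 fd]]] := trichotomy f.
- have [k fk] := affine_conj_fibered fA; exists (h * k)%g.
  by rewrite conjgM.
- by exists h.
case: (deg_mult_not_conj_square d1 fd); exists (g ^ h)%g.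
by rewrite -conjXg fg -conjJg.
Qed.
End Trichotomy.

(** * Differences of polynomials *)

Section Differences.
Variable K : numFieldType.
Implicit Types (p q : {poly K}) (b c : K).

Definition shift c p := p \Po ('X + c%:P).

Lemma shiftE c p x : (shift c p).[x] = p.[x + c].
Proof. by rewrite horner_comp hornerD hornerX hornerC. Qed.

(** The values at the points n c for natural n are all equal. *)
Lemma shift_fixed_const c p : c != 0 -> shift c p = p -> p = (p.[0])%:P.
Proof.
move=> c0 pc; apply/eqP; rewrite -subr_eq0; apply: contraTT isT => nz.
have pn n : p.[n%:R * c] = p.[0].
  elim: n => [|n IH]; first by rewrite mul0r.
  by rewrite -IH -{2}pc shiftE -addn1 natrD mulrDl mul1r.
have := max_poly_roots nz (rs := [seq n%:R * c | n <- iota 0 (size (p - (p.[0])%:P))]).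
rewrite size_map size_iota ltnn => abs; suff: false by [].
apply: abs; first by apply/allP => x /mapP[n _ ->]; rewrite rootE !hornerE pn subrr.
rewrite map_inj_uniq ?iota_uniq // => i j /(mulIf c0) /eqP.
by rewrite eqr_nat => /eqP.
Qed.

(** The differences of the powers X^(n+1) are of degree exactly n, so they
    span all polynomials. *)
Lemma shift_difference c p : c != 0 -> exists q, shift c q - q = p.
Proof.
move=> c0; pose A p := exists q, shift c q - q = p.
have AD p1 p2 : A p1 -> A p2 -> A (p1 + p2).
  move=> [q1 <-] [q2 <-]; exists (q1 + q2); rewrite /shift comp_polyD; ring.
have AZ a p1 : A p1 -> A (a *: p1).
  by move=> [q <-]; exists (a *: q); rewrite /shift comp_polyZ scalerBr.
have A0 : A 0 by exists 0; rewrite /shift comp_poly0 subr0.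
have AX n : A 'X^n.
  elim/ltn_ind: n => n IH.
  have e : shift c 'X^(n.+1) - 'X^(n.+1) = (n.+1%:R * c) *: 'X^n +
      \sum_(i < n) (c ^+ (n.+1 - i) *+ 'C(n.+1, i)) *: 'X^i :> {poly K}.
    rewrite /shift comp_Xn_poly ['X + c%:P]addrC exprDn big_ord_recr /= subnn expr0 mul1r.
    rewrite binn mulr1n addrK big_ord_recr /= subSnn expr1 binSn addrC; congr (_ + _).
      by rewrite mulr_natl -mul_polyC polyCMn mulrnAl.
    apply: eq_bigr => i _; rewrite -mul_polyC polyCMn polyC_exp mulrnAl //.
  have -> : 'X^n = (n.+1%:R * c)^-1 *: ((shift c 'X^(n.+1) - 'X^(n.+1)) +
      (-1) *: \sum_(i < n) (c ^+ (n.+1 - i) *+ 'C(n.+1, i)) *: 'X^i) :> {poly K}.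
    rewrite e scaleN1r addrK scalerA mulVf ?scale1r //.
    by rewrite mulf_neq0 // pnatr_eq0.
  apply: (AZ); apply: (AD); first by exists 'X^(n.+1).
  by apply: (AZ); apply: (big_ind A A0 AD) => i _; apply: AZ; apply: IH.
rewrite -(coefK p) poly_def; apply: (big_ind A A0 AD) => i _; exact/AZ/AX.
Qed.

Lemma size_shift_difference c p : c != 0 -> (1 < size p)%N ->
  shift c p - p != 0 /\ (size (shift c p - p)%R < size p)%N.
Proof.
move=> c0 p1; split.
  rewrite subr_eq0; apply: contraTneq p1 => /(shift_fixed_const c0) ->.
  by rewrite -leqNgt size_polyC_leq1.
have s2 : size ('X + c%:P) = 2%N by rewrite size_XaddC.
have ss : size (shift c p) = size p by rewrite size_comp_poly2.
rewrite -(prednK (ltnW p1)) ltnS; apply/leq_sizeP => j; rewrite leq_eqVlt.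
case/orP => [/eqP <-|lt]; last first.
  rewrite coefB !nth_default ?subrr ?ss //; by rewrite -(prednK (ltnW p1)).
rewrite coefB -lead_coefE -[in (size p).-1]ss -lead_coefE /shift.
by rewrite lead_coef_comp ?s2 // lead_coefXaddC expr1n mulr1 subrr.
Qed.
End Differences.

(** * Relations and the normal closure of a shear *)

Section Relations.
Variable R : realType.
Local Notation C := R[i].
Local Notation G := (SAutC2 R).
Local Notation shear := (@shear R).
Local Notation tri := (@tri R).
Local Notation turn := (turn R).
Implicit Types (f g h : G) (x y a b c : C) (p q : {poly C}).

Definition diag a : G := tri a 0 0.

Lemma diagE a x y : a != 0 -> diag a (pt x y) = pt (a * x) (a^-1 * y).
Proof. by move=> a0; rewrite triE // horner0 !addr0. Qed.

Lemma diag_shearC a c : a != 0 ->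
  (diag a * shear c%:P = shear (a * c)%:P * diag a)%g.
Proof.
move=> a0; apply: saut_ext => x y.
by rewrite !sautM !shearE !diagE // shearE !hornerC mulrDr.
Qed.

(** Conjugation by diag a multiplies the monomial shear c y^n by a^(n+1). *)
Lemma diag_shearXn a c n : a != 0 -> a ^+ n.+1 = 1 ->
  (diag a * shear (c *: 'X^n) = shear (c *: 'X^n) * diag a)%g.
Proof.
move=> a0 an; apply: saut_ext => x y.
rewrite !sautM !shearE !diagE // shearE !(hornerZ, hornerXn) exprMn mulrDr.
have -> : a^-1 ^+ n = a.
  by apply: (mulfI (expf_neq0 n a0)); rewrite -exprMn divff // expr1n -exprSr an.
by congr pt; ring.
Qed.

(** The shear of p is the commutator of a vertical translation with the shear
    of q. As every p is a difference, every shear is such a commutator. *)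
Lemma lshear_shear_shift c p q : shift (- c) q - q = p ->
  (lshear c%:P * shear q = shear p * (shear q * lshear c%:P))%g.
Proof.
move=> <-; apply: saut_ext => x y.
rewrite !sautM !(lshearE, shearE) hornerD hornerN shiftE !hornerC addrK.
by congr pt; ring.
Qed.

Lemma lshear_const c : lshear c%:P = (turn * shear c%:P * turn^-1)%g.
Proof. by rewrite lshear_turn comp_polyC. Qed.

Lemma turn_factor : turn = (shear (- 'X) * lshear 'X * shear (- 'X))%g.
Proof.
apply: saut_ext => x y; rewrite !sautM turnE shearE lshearE shearE.
by rewrite !(hornerN, hornerX); congr pt; ring.
Qed.

Lemma triM a p b a' p' b' : a != 0 -> a' != 0 ->
  exists r c, (tri a p b * tri a' p' b')%g = tri (a * a') r c.
Proof.
move=> a0 a'0; exists (a *: p' + (p \Po (a'^-1 *: 'X + b'%:P))), (a^-1 * b' + b).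
apply: saut_ext => x y; rewrite sautM !triE ?mulf_neq0 //.
rewrite !(hornerD, hornerZ, hornerX, hornerC, horner_comp) invfM.
by congr pt; ring.
Qed.

Lemma triX a p b n : a != 0 -> exists r c, (tri a p b ^+ n)%g = tri (a ^+ n) r c.
Proof.
move=> a0; elim: n => [|n [r [c IH]]].
  exists 0, 0; rewrite expg0 expr0; exact: (esym (shear0 R)).
by rewrite expgS IH exprS; apply: triM; rewrite ?expf_neq0.
Qed.

(** Triangular automorphisms with a = 1 commute modulo shears. *)
Lemma tri1_comm p b p' b' : exists m,
  (tri 1%R p b * tri 1%R p' b' = shear m * (tri 1%R p' b' * tri 1%R p b))%g.
Proof.
pose k : {poly C} := p' + (p \Po ('X + b'%:P)) - (p + (p' \Po ('X + b%:P))).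
exists (k \Po ('X - (b + b')%:P)); apply: saut_ext => x y.
rewrite !sautM !triE ?oner_neq0 // /k invr1 !mul1r addr0.
rewrite !(hornerD, hornerN, hornerX, hornerC, horner_comp).
have -> : y + b + b' - (b + b') = y by ring.
by congr pt; ring.
Qed.

Lemma tri_inj a p b a' p' b' : a != 0 -> a' != 0 -> tri a p b = tri a' p' b' ->
  [/\ a = a', p = p' & b = b'].
Proof.
move=> a0 a'0 e; have E x y : pt (a * x + p.[y]) (a^-1 * y + b) =
    pt (a' * x + p'.[y]) (a'^-1 * y + b') by rewrite -!triE // e.
have pp : p = p'.
  by apply: poly_ext => y; have [] := pt_inj (E 0 y); rewrite !mulr0 !add0r.
have [+ _] := pt_inj (E 1 0); rewrite pp !mulr1 => /addIr ->; split=> //.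
by have [_] := pt_inj (E 0 0); rewrite !mulr0 !add0r.
Qed.

Lemma shear_inj : injective shear.
Proof. by move=> p q /tri_inj[]; rewrite ?oner_neq0. Qed.

Lemma lshear_inj : injective (@lshear R).
Proof.
move=> p q e; apply: poly_ext => x.
have : lshear p (pt x 0) = lshear q (pt x 0) by rewrite e.
by rewrite !lshearE !add0r => /pt_inj[].
Qed.
End Relations.

Section Kernel.
Variable R : realType.
Local Notation C := R[i].
Local Notation G := (SAutC2 R).
Local Notation shear := (@shear R).
Local Notation turn := (turn R).
Implicit Types (f g h : G) (c : C) (p q : {poly C}).
Variable phi : G -> G.
Hypothesis phiM : {morph phi : f g / (f * g)%g}.

Lemma morph1 : phi 1%g = 1%g.
Proof. by apply: (mulgI (phi 1%g)); rewrite -phiM !mulg1. Qed.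

Lemma morphV f : phi (f^-1)%g = (phi f)^-1%g.
Proof. by apply: (mulgI (phi f)); rewrite -phiM !mulgV morph1. Qed.

Lemma morphX f n : phi (f ^+ n)%g = (phi f ^+ n)%g.
Proof. by elim: n => [|n IH]; rewrite ?expg0 ?morph1 // !expgS phiM IH. Qed.

(** Commutators with a vertical translation lower the degree of p until a
    nontrivial horizontal translation lies in the kernel. Conjugating by
    diagonal maps and the quarter turn gives all translations, commutators of
    these with shears give all shears, and shears with the quarter turn
    generate the group. *)
Lemma shear_kernel p : p != 0 -> phi (shear p) = 1%g -> forall f, phi f = 1%g.
Proof.
move=> p0 phip.
have N10 : -1 != 0 :> C by rewrite oppr_eq0 oner_neq0.
have [c c0 phic] : exists2 c, c != 0 & phi (shear c%:P) = 1%g.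
  have [n] := ubnP (size p); elim: n p p0 phip => // n IH p p0 phip sp.
  have [p1|p2] := leqP (size p) 1.
    have /size_poly1P[c c0 pc] : size p == 1%N by rewrite eqn_leq p1 size_poly_gt0.
    by exists c; rewrite // -pc.
  have [d0 ds] := size_shift_difference N10 p2.
  apply: IH d0 _ _; last by apply: leq_trans ds _; rewrite -ltnS.
  have /(congr1 phi) := lshear_shear_shift (erefl (shift (-1) p - p)).
  by rewrite !phiM phip mul1g mulg1 -[X in X = _]mul1g => /mulIg ->.
have phiC a : phi (shear a%:P) = 1%g.
  have [->|a0] := eqVneq a 0; first by rewrite polyC0 shear0 morph1.
  have ac0 : a / c != 0 by rewrite mulf_neq0 ?invr_eq0.
  have /(congr1 phi) := diag_shearC c ac0; rewrite divfK // !phiM phic mulg1.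
  by rewrite -[X in X = _]mul1g => /mulIg ->.
have phil1 : phi (lshear 1%:P) = 1%g.
  by rewrite lshear_const !phiM phiC mulg1 -phiM mulgV morph1.
have phiU q : phi (shear q) = 1%g.
  have [r rq] := shift_difference q N10.
  have /(congr1 phi) := lshear_shear_shift rq; rewrite !phiM phil1 mul1g mulg1.
  by rewrite -[X in X = _]mul1g => /mulIg ->.
have phiT : phi turn = 1%g.
  rewrite turn_factor !phiM !phiU lshear_turn !phiM phiU !mulg1 !mul1g.
  by rewrite -phiM mulgV morph1.
by apply: jung_generation => // f g; rewrite phiM => -> ->; rewrite mulg1.
Qed.
End Kernel.

(** * Derivatives at fixed points *)

Lemma mxtrace_similar (S : comUnitRingType) n (A B M : 'M[S]_n) :
  M \in unitmx -> M *m B = A *m M -> \tr B = \tr A.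
Proof.
by move=> Mu MB; rewrite -[A](mulmxK Mu) -MB mxtrace_mulC mulmxA mulVmx // mul1mx.
Qed.

Section Derivative.
Variable R : realType.
Local Notation C := R[i].
Local Notation G := (SAutC2 R).
Local Notation shear := (@shear R).
Local Notation tri := (@tri R).
Local Notation turn := (turn R).
Implicit Types (f g h : G) (x y a b c : C) (p q : {poly C}) (v : 'rV[C]_2).

Definition components f : 'rV[{mpoly C[2]}]_2 := sval (cid (saut_funP f)).

Lemma componentsE f : saut_fun f = polymap (components f).
Proof. by rewrite /components; case: cid => F []. Qed.

Definition jac_at f v : 'M[C]_2 := map_mx (meval (v 0)) (jacobian (components f)).

(** Its determinant is the Jacobian determinant, which is 1. *)
Lemma jac_at_unit f v : jac_at f v \in unitmx.
Proof.
rewrite unitmxE /jac_at det_map_mx /components; case: cid => F [_ _ /= ->].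
by rewrite rmorph1 unitr1.
Qed.

Lemma jac_atM f g v : jac_at (f * g)%g v = jac_at f (g v) *m jac_at g v.
Proof.
have -> : jac_at (f * g)%g v =
    map_mx (meval (v 0)) (jacobian (poly_comp (components f) (components g))).
  congr (map_mx _ (jacobian _)); apply: polymap_inj.
  by rewrite polymap_comp -!componentsE.
rewrite jacobian_comp map_mxM; congr (_ *m _).
apply/matrixP => i j; rewrite !mxE [LHS]comp_mpoly_meval; apply: meval_eq => k.
by rewrite tnth_mktuple componentsE mxE.
Qed.

Lemma jac_at_tri a p b v : a != 0 -> \tr (jac_at (tri a p b) v) = a + a^-1.
Proof.
move=> a0; have cE : components (tri a p b) =
    polypair (a *: 'X_0 + lift_y p) (a^-1 *: 'X_1 + b%:MP).
  apply: polymap_inj; rewrite -componentsE; apply/funext => w.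
  by rewrite -(pt_eta w) triE // -tri_mapE.
rewrite /mxtrace sum_ord2 /jac_at cE !mxE /xy /= -(pt_eta v).
have ptE (P : {mpoly C[2]}) : P.@[(pt (v 0 0) (v 0 1)) 0] = P.@[xy (v 0 0) (v 0 1)].
  by apply: meval_eq => j; rewrite mxE.
rewrite !ptE; congr (_ + _).
  by rewrite mderivD mderivZ mderivXU lift_y_dx addr0 mevalZ /= meval1 mulr1.
by rewrite mderivD mderivZ mderivXU mderivC addr0 mevalZ /= meval1 mulr1.
Qed.

Lemma tri_fixed_point a p b : a != 0 -> a != 1 ->
  exists v, forall w, tri a p b w = w <-> w = v.
Proof.
move=> a0 a1; have a1' : 1 - a^-1 != 0.
  by rewrite subr_eq0 eq_sym invr_eq1.
have a1'' : 1 - a != 0 by rewrite subr_eq0 eq_sym.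
pose y := b / (1 - a^-1); exists (pt (p.[y] / (1 - a)) y) => w.
rewrite -(pt_eta w) triE //; split=> [/pt_inj[e0 e1]|/pt_inj[-> ->]].
  have ey : w 0 1 = y.
    apply: (mulIf a1'); rewrite divfK // mulrBr mulr1 -{1}e1; ring.
  rewrite ey in e0 *; congr pt; apply: (mulIf a1''); rewrite divfK //.
  by rewrite mulrBr mulr1 -{1}e0; ring.
congr pt; last by rewrite /y; field; rewrite a0 subr_eq0 a1.
by field.
Qed.

(** A conjugating map h must fix the unique fixed point v of the triangular
    map, since v is also fixed by the n-th power. By the chain rule the
    derivatives at v of the map and of its n-th power are then similar, so
    they have the same trace. *)
Lemma tri_power_conj a p b n h : a != 0 -> a != 1 ->
  (tri a p b ^+ n = tri a p b ^ h)%g -> a ^+ n + a ^- n = a + a^-1.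
Proof.
move=> a0 a1 th; have [v vP] := tri_fixed_point p b a0 a1.
set t := tri a p b in th vP.
have tv : t v = v by apply/vP.
have tnv : (t ^+ n)%g v = v.
  by elim: n {th} => [|n IH]; rewrite ?expg0 // expgS sautM IH.
have thn : (h * t ^+ n = t * h)%g by rewrite th conjgE mulVKg.
have hv : h v = v by apply/vP; rewrite -sautM -thn sautM tnv.
have := congr1 (fun f => jac_at f v) thn; rewrite /= !jac_atM tnv hv => JM.
have [r [c tn]] := triX p b n a0.
rewrite -(jac_at_tri r c v (expf_neq0 n a0)) -(jac_at_tri p b v a0) -/t.
by rewrite -tn; apply: mxtrace_similar (jac_at_unit h v) JM.
Qed.

(** With s = a + 1/a the hypotheses read s^2 - 2 = s and s^3 - 3 s = s, hence
    s = 2. *)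
Lemma square_cube_trace (a : C) : a != 0 -> a ^+ 2 + a ^- 2 = a + a^-1 ->
  a ^+ 3 + a ^- 3 = a + a^-1 -> a = 1.
Proof.
move=> a0; set s := a + a^-1 => e2 e3.
have s2 : s ^+ 2 = s + 2 by rewrite -[in RHS]e2 /s; field.
have s3 : s ^+ 3 = 4 * s.
  have -> : s ^+ 3 = (a ^+ 3 + a ^- 3) + 3 * s by rewrite /s; field.
  by rewrite e3; ring.
have s_2 : s = 2.
  have : s * s ^+ 2 = 4 * s by rewrite -exprS.
  rewrite s2 mulrDr -expr2 s2 => e.
  have : s = 2 - (s + 2 + s * 2 - 4 * s) by ring.
  by rewrite e subrr subr0.
have : (a - 1) ^+ 2 = a * (s - 2) by rewrite /s; field.
by rewrite s_2 subrr mulr0 => /eqP; rewrite sqrf_eq0 subr_eq0 => /eqP.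
Qed.
End Derivative.

(** * Centralizers of shears *)

(** On each line y = t with p(t) nonzero, h is periodic and hence constant;
    the finitely many other values of t are covered by density. *)
Lemma shear_invariant (K : numFieldType) (h : {mpoly K[2]}) (p : {poly K}) :
  p != 0 -> (forall x y, h.@[xy (x + p.[y]) y] = h.@[xy x y]) ->
  forall x y, h.@[xy x y] = h.@[xy 0 y].
Proof.
move=> p0 inv x y; pose s z := on_curve z%:P 'X h.
have sE z t : (s z).[t] = h.@[xy z t] by rewrite on_curveE hornerC hornerX.
(* The factor p vanishes exactly on the lines where no period is available. *)
suff : (s x - s 0) * p = 0.
  move/eqP; rewrite mulf_eq0 (negPf p0) orbF subr_eq0 => /eqP e.
  by rewrite -!sE e.
apply: poly_ext => t; rewrite hornerM hornerD hornerN horner0 !sE.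
have [->|pt0] := eqVneq p.[t] 0; first by rewrite mulr0.
pose r := on_curve 'X t%:P h.
have rE z : r.[z] = h.@[xy z t] by rewrite on_curveE hornerC hornerX.
have rc : r = (r.[0])%:P.
  by apply: (shift_fixed_const pt0); apply: poly_ext => z; rewrite shiftE !rE inv.
by rewrite -!rE rc !hornerC subrr mul0r.
Qed.

Section Centralizers.
Variable R : realType.
Local Notation C := R[i].
Local Notation G := (SAutC2 R).
Local Notation shear := (@shear R).
Local Notation tri := (@tri R).
Local Notation turn := (turn R).
Implicit Types (f g h : G) (x y a b c : C) (p q : {poly C}) (v : 'rV[C]_2).

Lemma saut_app f g v : f = g -> f v = g v. Proof. by move->. Qed.

Lemma comm_shear_fibered f p p' : p != 0 ->
  (f * shear p = shear p' * f)%g -> fibered f.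
Proof.
move=> p0 fp; have [F0 [F1 [fF _ _]]] := saut_polys f.
have inv x y : F1.@[xy (x + p.[y]) y] = F1.@[xy x y].
  have := saut_app (pt x y) fp.
  by rewrite !sautM shearE fF !polymap_pt shearE => /pt_inj[].
by move=> x x' y; rewrite fF !polymap_pt !pt1 !(shear_invariant p0 inv _ y).
Qed.

Lemma comm_shearC f a a' : a != 0 -> (f * shear a%:P = shear a'%:P * f)%g ->
  exists k r b, [/\ k != 0, f = tri k r b & k * a = a'].
Proof.
move=> a0 fa; have aC0 : a%:P != 0 :> {poly C} by rewrite polyC_eq0.
have [k [r [b [k0 fE]]]] := fibered_tri (comm_shear_fibered aC0 fa).
exists k, r, b; split=> //; have := saut_app (pt 0 0) fa.
rewrite fE !sautM shearE triE // triE // shearE => /pt_inj[+ _].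
by rewrite !hornerC mulr0 !add0r addrC => /addrI.
Qed.

Lemma tri_comm_shear a r b p : a != 0 -> (tri a r b * shear p = shear p * tri a r b)%g ->
  a *: p = p \Po (a^-1 *: 'X + b%:P).
Proof.
move=> a0 e; apply: poly_ext => y; have := saut_app (pt 0 y) e.
rewrite !sautM shearE triE // triE // shearE => /pt_inj[+ _].
rewrite mulr0 !add0r addrC => /addrI.
by rewrite hornerZ horner_comp !(hornerD, hornerZ, hornerX, hornerC).
Qed.

(** Compare leading coefficients in a p(y) = p(y / a + b). *)
Lemma tri_comm_shear_root a r b p : a != 0 -> p != 0 ->
  (tri a r b * shear p = shear p * tri a r b)%g -> a ^+ size p = 1.
Proof.
move=> a0 p0 /(tri_comm_shear a0)/(congr1 lead_coef).
have s2 : size (a^-1 *: 'X : {poly C}) = 2%N.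
  by rewrite size_scale ?invr_eq0 // size_polyX.
have lt2 : (size (b%:P : {poly C}) < size (a^-1 *: 'X : {poly C}))%N.
  by rewrite s2 ltnS size_polyC_leq1.
have sq : size (a^-1 *: 'X + b%:P : {poly C}) = 2%N by rewrite size_polyDl.
have lq : lead_coef (a^-1 *: 'X + b%:P : {poly C}) = a^-1.
  by rewrite lead_coefDl // lead_coefZ lead_coefX mulr1.
rewrite lead_coefZ lead_coef_comp ?sq // lq mulrC => /mulfI.
rewrite lead_coef_eq0 => /(_ p0) e.
have sp : (0 < size p)%N by rewrite size_poly_gt0.
by rewrite -(prednK sp) exprS {1}e -exprMn mulVf // expr1n.
Qed.

Lemma tri1_comm_shear r b p : (1 < size p)%N ->
  (tri 1%R r b * shear p = shear p * tri 1%R r b)%g -> b = 0.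
Proof.
move=> p1 /(tri_comm_shear (oner_neq0 _)); rewrite invr1 !scale1r => e.
apply/eqP; apply: contraTT p1 => b0.
by rewrite (shift_fixed_const b0 (esym e)) -leqNgt size_polyC_leq1.
Qed.

Lemma shearX p n : (shear p ^+ n)%g = shear (p *+ n).
Proof.
elim: n => [|n IH]; first by rewrite expg0 mulr0n shear0.
by rewrite expgS IH mulrS shearM.
Qed.

Lemma lshearM p q : lshear (p + q) = (lshear p * lshear q)%g.
Proof.
apply: saut_ext => x y; rewrite sautM !lshearE hornerD.
by rewrite -addrA [q.[_] + _]addrC.
Qed.

Lemma lshearX p n : (lshear p ^+ n)%g = lshear (p *+ n).
Proof.
elim: n => [|n IH]; last by rewrite expgS IH mulrS lshearM.
by rewrite expg0 mulr0n; apply: saut_ext => x y; rewrite lshearE horner0 addr0.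
Qed.

Lemma lshear_shearC a b : (lshear b%:P * shear a%:P = shear a%:P * lshear b%:P)%g.
Proof. by apply: saut_ext => x y; rewrite !sautM !(lshearE, shearE) !hornerC. Qed.

Lemma shear_comm p q : (shear p * shear q = shear q * shear p)%g.
Proof. by rewrite -!shearM addrC. Qed.

(** So a triangular map with a = 1 and b nonzero is conjugate to a vertical
    translation, every polynomial being a difference. *)
Lemma tri1_shear p b q : shift b q - q = p ->
  (tri 1%R p b * shear q = shear q * lshear b%:P)%g.
Proof.
move=> <-; apply: saut_ext => x y; rewrite !sautM shearE triE ?oner_neq0 //.
rewrite lshearE shearE invr1 !mul1r !(hornerD, hornerN, shiftE) hornerC.
by congr pt; ring.
Qed.

Section Morphism.
Variable phi : G -> G.
Hypothesis phiM : {morph phi : f g / (f * g)%g}.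
Hypothesis phi_shear_inj : forall p, phi (shear p) = 1%g -> p = 0.
Local Notation phiX := (morphX phiM).

Lemma shear1_power n : (0 < n)%N ->
  (shear 1%:P ^+ n = shear 1%:P ^ (diag n%:R)^-1)%g.
Proof.
move=> n0; rewrite conjgE invgK mulgA diag_shearC ?mulr1; last by rewrite pnatr_eq0 -lt0n.
by rewrite mulgK shearX polyCMn.
Qed.

(** Suppose the image of the unit translation were the shear of a nonconstant
    p. Its centralizer consists of triangular maps whose multiplier k
    satisfies k^(size p) = 1, so powers of exponent size p of elements of the
    centralizer are shears. The vertical translations and the shears commute
    with, or are compared through, the unit translation and are all such
    powers, so their images would commute, and the unit translation, which is
    a commutator of two of them, would be killed. *)
Lemma phi_shear1_const p : phi (shear 1%:P) = shear p -> (size p <= 1)%N.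
Proof.
move=> phi1p; rewrite leqNgt; apply/negP => p1.
have p0 : p != 0 by rewrite -size_poly_gt0 ltnW.
have root_shear g : (g * shear 1%:P = shear 1%:P * g)%g ->
    exists r, phi (g ^+ size p)%g = shear r.
  move=> /(congr1 phi); rewrite !phiM phi1p => gp.
  have [k [r [b [k0 gE]]]] := fibered_tri (comm_shear_fibered p0 gp).
  have kp : k ^+ size p = 1 by apply: (@tri_comm_shear_root _ r b); rewrite // -gE.
  have [r' [b' gpE]] := triX r b (size p) k0.
  exists r'; rewrite phiX gE gpE kp /shear; congr tri.
  apply: (@tri1_comm_shear r' _ p p1); rewrite -kp -gpE -gE.
  by apply: commuteX2 (1%N) gp.
have np : (size p)%:R != 0 :> C by rewrite pnatr_eq0 -lt0n ltnW.
have npK (q : {poly C}) : ((size p)%:R^-1 *: q) *+ size p = q.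
  by rewrite -scaler_nat scalerA divff ?scale1r.
have [r1 r1E] := root_shear (lshear ((size p)%:R^-1)%:P) (lshear_shearC _ _).
have nV : (size p)%:R^-1 *+ size p = 1 :> C by rewrite -[LHS]mulr_natl divff.
rewrite lshearX -polyCMn nV in r1E.
have N10 : -1 != 0 :> C by rewrite oppr_eq0 oner_neq0.
have [q qE] := shift_difference 1%:P N10.
have [r2 r2E] := root_shear (shear ((size p)%:R^-1 *: q)) (shear_comm _ _).
rewrite shearX npK in r2E.
have /(congr1 phi) := lshear_shear_shift qE; rewrite !phiM r1E r2E shear_comm.
rewrite -[X in X = _]mul1g => /mulIg/esym/phi_shear_inj/eqP.
by rewrite polyC_eq0 oner_eq0.
Qed.
End Morphism.
End Centralizers.

(** * Images of translations *)

Section Normalization.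
Variable R : realType.
Local Notation C := R[i].
Local Notation G := (SAutC2 R).
Local Notation shear := (@shear R).
Local Notation tri := (@tri R).
Local Notation turn := (turn R).
Implicit Types (f g h : G) (x y a b c : C) (p q : {poly C}) (v : 'rV[C]_2)
  (phi : G -> G).

Lemma conj_morph phi h : {morph phi : f g / (f * g)%g} ->
  {morph (fun f => phi f ^ h)%g : f g / (f * g)%g}.
Proof. by move=> phiM f g; rewrite phiM conjMg. Qed.

Lemma conj_faithful phi h : (forall p, phi (shear p) = 1%g -> p = 0) ->
  forall p, (phi (shear p) ^ h)%g = 1%g -> p = 0.
Proof. by move=> inj p /eqP; rewrite conjg_eq1 => /eqP/inj. Qed.

Lemma lshear_conj_turn c : (lshear c%:P ^ turn)%g = shear c%:P.
Proof. by rewrite lshear_const conjgE mulgVK mulKg. Qed.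

(** The unit translation is conjugate to all its powers, hence so is its
    image. It is therefore conjugate to a triangular map; the multiplier a is
    1 by the trace identities for the square and the cube; and the case of a
    nonconstant shear is excluded by phi_shear1_const, so that a translation
    remains. *)
Lemma phi_shear1_conj phi : {morph phi : f g / (f * g)%g} ->
  (forall p, phi (shear p) = 1%g -> p = 0) ->
  exists h c, c != 0 /\ (phi (shear 1%:P) ^ h)%g = shear c%:P.
Proof.
move=> phiM phi_inj.
have powE n : (0 < n)%N -> (phi (shear 1%:P) ^+ n =
    phi (shear 1%:P) ^ phi (diag n%:R)^-1)%g.
  move=> n0; rewrite -(morphX phiM) (shear1_power R n0) !conjgE !phiM.
  by rewrite !(morphV phiM).
have [h0 tE] := conj_square_fibered (powE 2%N isT).
pose psi f := (phi f ^ h0)%g.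
have psiM : {morph psi : f g / (f * g)%g} by apply: conj_morph.
have psi_inj : forall p, psi (shear p) = 1%g -> p = 0 by apply: conj_faithful.
have [a [p [b [a0 psi1]]]] := fibered_tri tE; rewrite -/(psi _) in psi1.
have psi_pow n : (0 < n)%N -> (tri a p b ^+ n = tri a p b ^ psi (diag n%:R)^-1)%g.
  move=> n0; rewrite -psi1 -(morphX psiM) (shear1_power R n0) !conjgE !psiM.
  by rewrite !(morphV psiM).
have a1 : a = 1.
  apply: contraTeq isT => a1; case/eqP: (a1).
  apply: square_cube_trace => //.
    exact: tri_power_conj a0 a1 (psi_pow 2%N isT).
  exact: tri_power_conj a0 a1 (psi_pow 3%N isT).
rewrite {}a1 {a0 psi_pow} in psi1.
have [b0|b0] := eqVneq b 0.
  rewrite b0 in psi1; have := phi_shear1_const psiM psi_inj psi1 => p1.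
  have pC := size1_polyC p1; exists h0, p`_0; rewrite -pC; split=> //.
  apply: contraTneq isT => p00; have := psi_inj 1%:P.
  rewrite psi1 pC p00 -/(shear _) (shear0 R) => /(_ erefl)/eqP.
  by rewrite polyC_eq0 oner_eq0.
have [q qE] := shift_difference p b0.
exists (h0 * (shear q * turn))%g, b; split=> //.
have qb : (tri 1%R p b ^ shear q)%g = lshear b%:P.
  by rewrite conjgE (tri1_shear qE) mulKg.
by rewrite conjgM -/(psi _) psi1 conjgM qb lshear_conj_turn.
Qed.

(** Every shear is a commutator of two elements of the centralizer of the unit
    translation. The images of these two lie in the centralizer of a
    translation, which is triangular with multiplier 1, and commutators of
    such maps are shears. *)
Lemma phi_shear phi c : {morph phi : f g / (f * g)%g} -> c != 0 ->
  phi (shear 1%:P) = shear c%:P -> forall p, exists q, phi (shear p) = shear q.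
Proof.
move=> phiM c0 phi1 p.
have cent g : (g * shear 1%:P = shear 1%:P * g)%g -> exists r b, phi g = tri 1 r b.
  move=> /(congr1 phi); rewrite !phiM phi1 => /(comm_shearC c0)[k [r [b [k0 gE kc]]]].
  exists r, b; rewrite gE; congr tri; apply: (mulIf c0); by rewrite mul1r.
have N10 : -1 != 0 :> C by rewrite oppr_eq0 oner_neq0.
have [q qE] := shift_difference p N10.
have [r1 [b1 e1]] := cent _ (lshear_shearC 1 1).
have [r2 [b2 e2]] := cent _ (shear_comm q 1%:P).
have [m mE] := tri1_comm r1 b1 r2 b2; exists m.
have /(congr1 phi) := lshear_shear_shift qE; rewrite !phiM e1 e2 mE.
by move/mulIg.
Qed.

(** The image of the vertical unit translation commutes with a horizontal one,
    so it is triangular with multiplier 1. Its vertical part b is nonzero,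
    since otherwise it would commute with the images of all shears. A
    conjugation by a shear, which does not change the image of the horizontal
    translation, removes its horizontal part. *)
Lemma phi_normal_form phi : {morph phi : f g / (f * g)%g} ->
  (forall p, phi (shear p) = 1%g -> p = 0) ->
  exists h c b, [/\ c != 0, b != 0, (phi (shear 1%:P) ^ h)%g = shear c%:P &
    (phi (lshear 1%:P) ^ h)%g = lshear b%:P].
Proof.
move=> phiM phi_inj.
have [h0 [c [c0 psi1]]] := phi_shear1_conj phiM phi_inj.
pose psi f := (phi f ^ h0)%g; rewrite -/(psi _) in psi1.
have psiM : {morph psi : f g / (f * g)%g} by apply: conj_morph.
have psi_inj : forall p, psi (shear p) = 1%g -> p = 0 by apply: conj_faithful.
have := congr1 psi (lshear_shearC 1 1); rewrite !psiM psi1.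
move/(comm_shearC c0) => [k [r [b [k0 lE kc]]]].
have {k0} k1 : k = 1 by apply: (mulIf c0); rewrite mul1r.
rewrite {}k1 {kc} in lE.
have b0 : b != 0.
  apply: contraTneq isT => b0; rewrite b0 in lE.
  have N10 : -1 != 0 :> C by rewrite oppr_eq0 oner_neq0.
  have [q qE] := shift_difference 1%:P N10.
  have [m mE] := phi_shear psiM c0 psi1 q.
  have /(congr1 psi) := lshear_shear_shift qE; rewrite !psiM lE mE shear_comm.
  rewrite -[X in X = _]mul1g => /mulIg/esym/psi_inj/eqP.
  by rewrite polyC_eq0 oner_eq0.
have [q qE] := shift_difference r b0.
exists (h0 * shear q)%g, c, b; split=> //; rewrite conjgM -/(psi _).
  by rewrite psi1 conjgE shear_comm mulKg.
by rewrite lE conjgE (tri1_shear qE) mulKg.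
Qed.
End Normalization.

(** * Rigidity *)

Section Rigidity.
Variable R : realType.
Local Notation C := R[i].
Local Notation G := (SAutC2 R).
Local Notation shear := (@shear R).
Local Notation tri := (@tri R).
Local Notation turn := (turn R).
Implicit Types (f g h : G) (x y a b c : C) (p q : {poly C}) (v : 'rV[C]_2).
Variable phi : G -> G.
Hypothesis phiM : {morph phi : f g / (f * g)%g}.
Hypothesis phi_shear_inj : forall p, phi (shear p) = 1%g -> p = 0.
Variables c0 b0 : C.
Hypothesis c0_neq0 : c0 != 0.
Hypothesis b0_neq0 : b0 != 0.
Hypothesis phi_e1 : phi (shear 1%:P) = shear c0%:P.
Hypothesis phi_l1 : phi (lshear 1%:P) = lshear b0%:P.

(** Apply phi_shear to the endomorphism conjugated on both sides by the
    quarter turn. *)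
Lemma phi_lshear q : exists r, phi (lshear q) = lshear r.
Proof.
pose chi f := (phi (f ^ turn^-1) ^ turn)%g.
have chiM : {morph chi : f g / (f * g)%g}.
  by move=> f g; rewrite /chi conjMg phiM conjMg.
have chi1 : chi (shear 1%:P) = shear b0%:P.
  by rewrite /chi -(lshear_conj_turn 1) conjgK phi_l1 lshear_conj_turn.
have [r rE] := phi_shear chiM b0_neq0 chi1 (q \Po - 'X).
have XX (p : {poly C}) : (p \Po - 'X) \Po - 'X = p.
  by apply: poly_ext => z; rewrite !horner_comp !(hornerN, hornerX) opprK.
have lshearJ (p : {poly C}) : lshear p = (shear (p \Po - 'X) ^ turn^-1)%g.
  by rewrite lshear_turn conjgE invgK mulgA.
by exists (r \Po - 'X); rewrite !lshearJ XX -rE /chi conjgK.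
Qed.

(** Translations are sent to translations; x_image and y_image are the induced
    maps on the two coordinates (see phi_transl). *)
Definition x_image c := (phi (shear c%:P) (pt 0 0)) 0 0.
Definition y_image c := (phi (lshear c%:P) (pt 0 0)) 0 1.

Lemma phi_shearC c : phi (shear c%:P) = shear (x_image c)%:P.
Proof.
have [q qE] := phi_shear phiM c0_neq0 phi_e1 c%:P.
suff qC : q = (q.[0])%:P.
  by rewrite /x_image qE qC shearE pt0 add0r !hornerC.
apply: (shift_fixed_const (c := - b0)); first by rewrite oppr_eq0.
have := congr1 phi (lshear_shearC c 1); rewrite !phiM phi_l1 qE => e.
apply/eqP; rewrite -subr_eq0; apply/eqP.
have := lshear_shear_shift (erefl (shift (- b0) q - q)).
by rewrite e -[X in X = _]mul1g -(shear0 R) => /mulIg/shear_inj/esym.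
Qed.

Lemma phi_lshearC c : phi (lshear c%:P) = lshear (y_image c)%:P.
Proof.
have [q qE] := phi_lshear c%:P.
suff qC : q = (q.[0])%:P.
  by rewrite /y_image qE qC lshearE pt1 add0r !hornerC.
apply: (shift_fixed_const c0_neq0); apply: poly_ext => x; rewrite shiftE.
have := congr1 phi (lshear_shearC 1 c); rewrite !phiM phi_e1 qE.
move/(saut_app (pt x 0)); rewrite !sautM shearE !lshearE shearE !hornerC.
by rewrite !add0r => /pt_inj[].
Qed.

Definition transl x y : G := (shear x%:P * lshear y%:P)%g.

Lemma translE x y x' y' : transl x y (pt x' y') = pt (x' + x) (y' + y).
Proof. by rewrite sautM lshearE shearE !hornerC. Qed.

Lemma phi_transl x y x' y' :
  phi (transl x y) (pt x' y') = pt (x' + x_image x) (y' + y_image y).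
Proof. by rewrite phiM phi_shearC phi_lshearC translE. Qed.

Lemma x_image_inj : injective x_image.
Proof.
move=> c c' e; apply/eqP; rewrite -subr_eq0 -polyC_eq0; apply/eqP/phi_shear_inj.
by rewrite polyCB shearM shearN phiM (morphV phiM) !phi_shearC e mulgV.
Qed.

Lemma y_image_inj : injective y_image.
Proof.
have s2K c : phi (lshear c%:P) = 1%g -> c = 0.
  rewrite lshear_const !phiM (morphV phiM) => e.
  apply/eqP; rewrite -polyC_eq0; apply/eqP/phi_shear_inj.
  by apply: (mulgI (phi turn)); rewrite mulg1 -[RHS]mul1g -e mulgVK.
move=> c c' e; apply/eqP; rewrite -subr_eq0; apply/eqP/s2K.
by rewrite polyCB lshearM lshearN phiM (morphV phiM) !phi_lshearC e mulgV.
Qed.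

Lemma x_imageN c : x_image (- c) = - x_image c.
Proof.
have : phi (shear (- c)%:P) = (phi (shear c%:P))^-1%g.
  by rewrite polyCN shearN (morphV phiM).
by rewrite !phi_shearC -shearN -polyCN => /shear_inj/polyC_inj.
Qed.

Lemma y_imageN c : y_image (- c) = - y_image c.
Proof.
have : phi (lshear (- c)%:P) = (phi (lshear c%:P))^-1%g.
  by rewrite polyCN lshearN (morphV phiM).
by rewrite !phi_lshearC -lshearN -polyCN => /lshear_inj/polyC_inj.
Qed.

Lemma x_image_neq0 c : c != 0 -> x_image c != 0.
Proof.
move=> c_n0; apply: contra c_n0 => /eqP e; rewrite -polyC_eq0.
by apply/eqP/phi_shear_inj; rewrite phi_shearC e polyC0 shear0.
Qed.

Lemma N1_neq0 : -1 != 0 :> C. Proof. by rewrite oppr_eq0 oner_neq0. Qed.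

Definition neg : G := diag (-1).

Lemma negE x y : neg (pt x y) = pt (- x) (- y).
Proof. by rewrite diagE ?N1_neq0 // invrN1 !mulN1r. Qed.

(** The image of - id inverts the translations in the image, which forces it
    to be (x, y) |-> (r - x, b - y). *)
Lemma phi_neg : exists x0 y0, forall v, phi neg v = v <-> v = pt x0 y0.
Proof.
have := congr1 phi (diag_shearC 1 N1_neq0).
rewrite !phiM !phi_shearC mulr1 => /(comm_shearC (x_image_neq0 (oner_neq0 _))).
move=> [k [r [b [k0 nE ks]]]]; have {ks} kN : k = -1.
  by apply: (mulIf (x_image_neq0 (oner_neq0 _))); rewrite ks x_imageN mulN1r.
have negl c : (neg * lshear c%:P = lshear (- c)%:P * neg)%g.
  apply: saut_ext => x z; rewrite !sautM [in LHS]lshearE !negE [in RHS]lshearE.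
  by rewrite !hornerC opprD.
have rs c z : r.[z + y_image c] = r.[z].
  have := congr1 phi (negl c); rewrite !phiM !phi_lshearC y_imageN nE kN.
  move/(saut_app (pt 0 z)); rewrite !sautM [in LHS]lshearE !triE ?N1_neq0 //.
  by rewrite [in RHS]lshearE hornerC => /pt_inj[+ _]; rewrite !mulr0 !add0r.
have rC y : r.[y] = r.[0].
  have s20 : y_image 1 = b0 by apply: polyC_inj; apply: lshear_inj; rewrite -phi_lshearC.
  suff -> : r = (r.[0])%:P by rewrite !hornerC.
  apply: (shift_fixed_const b0_neq0); apply: poly_ext => z.
  by rewrite shiftE -s20 rs.
exists (r.[0] / 2), (b / 2) => v; rewrite -/neg nE kN -(pt_eta v) triE ?N1_neq0 //.
rewrite rC invrN1 !mulN1r; split=> [/pt_inj[ex ey]|/pt_inj[-> ->]].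
  have halve (u w : C) : - u + w = u -> u = w / 2.
    by move=> e; have -> : w = u + u by [rewrite -{2}e; ring]; field.
  by congr pt; apply: halve.
by congr pt; field.
Qed.

(** Whatever commutes with - id has an image that fixes the unique fixed point
    of the image of - id; this applies to the quarter turn and to diagonal
    maps. For a monomial shear c y^n with n > 0, take a nontrivial root of
    unity z with z^(n+1) = 1. The image of diag z fixes the point, commutes
    with the image of the shear, and has multiplier different from 1, so the
    image of the shear, which moves points horizontally, fixes the point as
    well. *)
Lemma common_fixed_point : exists v0, phi turn v0 = v0 /\
  forall p, p.[0] = 0 -> phi (shear p) v0 = v0.
Proof.
have [x0 [y0 negP]] := phi_neg; pose v0 := pt x0 y0.
have neg0 : phi neg v0 = v0 by apply/negP.
have cent g : (neg * g = g * neg)%g -> phi g v0 = v0.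
  move=> /(congr1 phi); rewrite !phiM => e; apply/negP.
  by rewrite -sautM e sautM neg0.
have turn0 : phi turn v0 = v0.
  by apply: cent; apply: saut_ext => x y; rewrite !sautM !(turnE, negE).
have diag0 a : a != 0 -> phi (diag a) v0 = v0.
  move=> a0; apply: cent; apply: saut_ext => x y.
  by rewrite !sautM !(diagE _ _ a0, negE) !mulrN.
exists v0; split=> // p p0.
have mon n c : phi (shear (c *: 'X^(n.+1))) v0 = v0.
  have [z z1 zn] := nontrivial_root_of_unity C (isT : (1 < n.+2)%N).
  have z0 : z != 0.
    by apply: contra_eq_neq zn => ->; rewrite exprS mul0r eq_sym oner_neq0.
  have [m mE] := phi_shear phiM c0_neq0 phi_e1 (c *: 'X^(n.+1)).
  have := congr1 phi (diag_shearC 1 z0); rewrite !phiM !phi_shearC mulr1.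
  move=> /(comm_shearC (x_image_neq0 (oner_neq0 _)))[k [r [b [k0 dE ks]]]].
  have k1 : k != 1.
    apply: contra z1 => /eqP k1; apply/eqP/x_image_inj.
    by rewrite -ks k1 mul1r.
  have := diag0 _ z0; rewrite dE triE // => /pt_inj[fx fy].
  have := congr1 phi (diag_shearXn c z0 zn); rewrite !phiM mE dE.
  move=> /(saut_app (pt x0 y0)); rewrite !sautM shearE triE // triE // shearE fx fy.
  move/pt_inj => [e _]; rewrite /v0.
  have : (k - 1) * m.[y0] = 0.
    have -> : (k - 1) * m.[y0] =
      (k * (x0 + m.[y0]) + r.[y0]) - (k * x0 + r.[y0]) - m.[y0] by ring.
    by rewrite e fx; ring.
  by move/eqP; rewrite mulf_eq0 subr_eq0 (negPf k1) /= => /eqP ->; rewrite addr0.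
pose A q := phi (shear q) v0 = v0.
have AD q1 q2 : A q1 -> A q2 -> A (q1 + q2).
  by rewrite /A shearM phiM sautM => e1 e2; rewrite e2.
have A0 : A 0 by rewrite /A shear0 (morph1 phiM).
rewrite -/(A p) -(coefK p) poly_def; apply: (big_ind A A0 AD) => -[[|i] lti] _ /=.
  by rewrite -horner_coef0 p0 scale0r.
exact: mon.
Qed.

(** Transporting the common fixed point v0 by the images of the translations
    defines an injective map from the plane to itself, sending (x, y) to phi
    (transl x y) v0. It intertwines each f with phi f: this holds for the
    shears and the quarter turn, because each of them composed with suitable
    translations fixes the origin and has an image that fixes v0, and it
    extends to the group they generate. So phi f determines f. *)
Lemma phi_injective : injective phi.
Proof.
have [v0 [turn0 shear0]] := common_fixed_point.
pose S f := forall x y x' y', f (pt x y) = pt x' y' ->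
  phi f (phi (transl x y) v0) = phi (transl x' y') v0.
have step g k x y x' y' : (g * transl x y = transl x' y' * k)%g -> phi k v0 = v0 ->
    phi g (phi (transl x y) v0) = phi (transl x' y') v0.
  by move=> e kv; rewrite -sautM -phiM e phiM sautM kv.
have SP f : S f.
  apply: jung_generation => [g h Sg Sh|p|] x y x' y'.
  - rewrite sautM -(pt_eta (h (pt x y))) phiM sautM => e.
    by rewrite (Sh x y _ _ (esym (pt_eta _))); apply: Sg.
  - rewrite shearE => /pt_inj[<- <-].
    apply: (step _ (shear (shift y p - (p.[y])%:P))); last first.
      by apply: shear0; rewrite hornerD hornerN shiftE hornerC add0r subrr.
    apply: saut_ext => u w; rewrite /transl !sautM !(shearE, lshearE).
    by rewrite !(hornerD, hornerN, shiftE, hornerC); congr pt; ring.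
  rewrite turnE => /pt_inj[<- <-]; apply: (step _ turn) => //.
  apply: saut_ext => u w; rewrite /transl !sautM !(turnE, shearE, lshearE).
  by rewrite !hornerC opprD.
move=> f g fg; apply: saut_ext => x y.
have := SP f x y _ _ (esym (pt_eta _)); rewrite fg (SP g x y _ _ (esym (pt_eta _))).
rewrite -(pt_eta v0) !phi_transl => /pt_inj[/addrI/x_image_inj e0 /addrI/y_image_inj e1].
by rewrite -(pt_eta (f (pt x y))) -(pt_eta (g (pt x y))) e0 e1.
Qed.
End Rigidity.

Section Main.
Variable R : realType.
Local Notation G := (SAutC2 R).

(** By shear_kernel a nontrivial endomorphism kills no shear, and after a
    conjugation it is in the normal form to which phi_injective applies. *)
Lemma nontrivial_injective (phi : G -> G) : {morph phi : f g / (f * g)%g} ->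
  ~ (forall f, phi f = 1%g) -> injective phi.
Proof.
move=> phiM nontriv.
have inj p : phi (shear p) = 1%g -> p = 0.
  move=> e; apply/eqP; apply: contra_notT nontriv => p0.
  exact: (shear_kernel phiM p0 e).
have [h [c [b [c0 b0 e1 l1]]]] := phi_normal_form phiM inj.
have psiM := conj_morph h phiM; have psi_inj := @conj_faithful _ _ h inj.
move=> f g fg; apply: (@phi_injective R (fun f => phi f ^ h)%g psiM psi_inj c b) => //.
by rewrite /= fg.
Qed.
End Main.

Theorem theorem2 (R : realType) :
  (forall phi : {multiplicative SAutC2 R -> SAutC2 R},
     ~ (forall f : SAutC2 R, phi f = 1%g) -> injective phi) /\
  (forall phi : {multiplicative SAutC2 R -> SAutC2 R},
     (forall g : SAutC2 R, exists f : SAutC2 R, phi f = g) -> bijective phi).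
Proof.
have inj (phi : {multiplicative SAutC2 R -> SAutC2 R}) :
    ~ (forall f, phi f = 1%g) -> injective phi.
  by apply: nontrivial_injective => f g; apply: gmulfM.
split=> // phi surj; have phi_inj : injective phi.
  apply: inj => triv; have [f] := surj (shear 1%:P).
  rewrite triv -(shear0 R) => /shear_inj/eqP.
  by rewrite eq_sym polyC_eq0 oner_eq0.
pose psi g := sval (cid (surj g)).
have psiK g : phi (psi g) = g := svalP (cid (surj g)).
by exists psi => // f; apply: phi_inj; rewrite psiK.
Qed.
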